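(* Let $T>0$, let $W=\{W_t,\ t\in[0,T]\}$ be a (standard, real) Brownian motion on some probability space $(\Omega,\mathcal F,P)$, and let $b\colon\mathbb R\to\mathbb R$ be a function satisfying all of the following hypotheses: (H1) $b(0)=0$; (H2) $b$ is non-decreasing on $(0,\infty)$; (H3) $b$ is continuous on $[0,\infty)$, and of class $C^1$ with $b'$ non-increasing on $(0,\infty)$; (H4) $b(|x|)\le b(-|x|)$ for all $x\in\mathbb R$; (H5) $b$ is non-increasing on $(-\infty,0]$; (H6) $b$ is continuous and there is a constant $C$ such that $|b(x)|\le C(1+|x|)$ for all $x\in\mathbb R$; (H7) $\displaystyle \operatorname{E}_P\Big[\int_0^T b'(|W_s|+)\,ds\Big]<\infty$. Then the stochastic differential equation $$X_t=\int_0^t b(X_s)\,ds+W_t,\qquad t\in[0,T],$$ has a unique path-by-path solution.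
   Context: For $z\ge 0$, $b'(z+):=\lim_{x\downarrow z}b'(x)$; the value $b'(0+)$ may be $+\infty$. Path-by-path solution: the equation is solved $\omega$-by-$\omega$, i.e. for each fixed continuous sample path $\omega_\cdot$ of the noise one considers the deterministic equation $x_t=\int_0^t b(x_s)\,ds+\omega_t$, $t\in[0,T]$, for a continuous unknown $x\colon[0,T]\to\mathbb R$ (no adaptedness to the filtration of the noise is required). ''The equation has a unique path-by-path solution'' means: for almost all sample paths $\omega$ of the noise, this deterministic equation has exactly one continuous solution on $[0,T]$. *)

(* Defs.v *)
From HB Require Import structures.
From mathcomp Require Import all_boot all_order all_algebra.
From mathcomp Require Import all_classical all_reals all_analysis.
From mathcomp Require Import measurable_realfun.

Set Implicit Arguments.
Unset Strict Implicit.
Unset Printing Implicit Defensive.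
Import Order.TTheory GRing.Theory Num.Theory.
Import numFieldNormedType.Exports.
Local Open Scope classical_set_scope.
Local Open Scope ring_scope.

Definition independent_RVs (d : measure_display) (Omega : measurableType d)
    (R : realType) (P : probability Omega R) (I : finType)
    (X : I -> {RV P >-> R}) : Prop :=
  forall (J : {set I}) (A : I -> set R),
    (forall i, i \in J -> measurable (A i)) ->
    P (\bigcap_(i in [set` J]) (X i @^-1` A i)) =
    (\prod_(i in J) P (X i @^-1` A i))%E.

Definition increment (d : measure_display) (Omega : measurableType d)
    (R : realType) (P : probability Omega R) (W : R -> {RV P >-> R})
    (s t : R) : {RV P >-> R} :=
  W t \- W s.

(* Only the restriction of W to the index set [0, T] is constrained: the values
   W t for t outside [0, T] are irrelevant. *)
Record is_brownian_motion (d : measure_display) (Omega : measurableType d)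
    (R : realType) (P : probability Omega R) (T : R)
    (W : R -> {RV P >-> R}) : Prop := IsBrownianMotion {
  bm_start : {ae P, forall w, W 0 w = 0} ;
  bm_continuous : {ae P, forall w, {within `[0, T], continuous (fun t : R => W t w)}} ;
  (* s < t is required because [normal_prob 0 0] is not a Dirac mass *)
  bm_gaussian : forall s t : R, 0 <= s -> s < t -> t <= T ->
    forall A : set R, measurable A ->
    distribution P (increment W s t) A =
    normal_prob 0 (Num.sqrt (t - s)) A ;
  bm_independent : forall (n : nat) (t : nat -> R), 0 <= t 0%N ->
    (forall i, (i < n)%N -> t i <= t i.+1) -> t n <= T ->
    independent_RVs (fun i : 'I_n => increment W (t i) (t i.+1))
}.

(* b'(z+), as an extended real. [lim] returns an unspecified value when the
   limit does not exist; it exists as soon as b' is monotone on (z, +oo). *)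
Definition right_limit_derive1 (R : realType) (b : R -> R) (z : R) : \bar R :=
  lim ((derive1 b x)%:E @[x --> z^'+]).

Definition is_solution (R : realType) (T : R) (b : R -> R) (omega : R -> R)
    (x : R -> R) : Prop :=
  {within `[0, T], continuous x} /\
  forall t : R, t \in `[0, T] ->
    x t = \int[lebesgue_measure]_(s in `[0, t]) b (x s) + omega t.

(* Solutions are functions on [0, T], here represented by functions on R, so
   uniqueness is equality on [0, T]. *)
Definition has_unique_solution (R : realType) (T : R) (b : R -> R)
    (omega : R -> R) : Prop :=
  exists x, is_solution T b omega x /\
    forall y, is_solution T b omega y -> {in `[0, T], y =1 x}.

Definition unique_path_by_path_solution (d : measure_display)
    (Omega : measurableType d) (R : realType) (P : probability Omega R) (T : R)
    (b : R -> R) (W : R -> Omega -> R) : Prop :=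
  {ae P, forall w, has_unique_solution T b (fun t : R => W t w)}.

(* Main.v *)
Require Import Defs.
From HB Require Import structures.
From mathcomp Require Import all_boot all_order all_algebra.
From mathcomp Require Import all_classical all_reals all_analysis.
From mathcomp Require Import measurable_realfun ring lra.

Set Implicit Arguments.
Unset Strict Implicit.
Unset Printing Implicit Defensive.
Import Order.TTheory GRing.Theory Num.Theory.
Import numFieldNormedType.Exports.
Local Open Scope classical_set_scope.
Local Open Scope ring_scope.

(** Uniqueness of the deterministic equation. The hypotheses on [b] give the
    one-sided bound [b y - b x <= b' `|x| * (y - x)] for [x <= y]. Hence, by
    Gronwall, no solution can exceed a solution [x] along which the integral of
    [b' `|x s|] is finite; if [x] is also the smallest solution it is the only
    one. The smallest solution is approached from below by replacing [b] by a
    slightly smaller, one-sided Lipschitz drift ([reg_drift]). It is not necessary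
    to pass to the limit: explicit Euler schemes for the smaller drifts, driven by
    the given path, are compared directly with the solutions. Every solution is
    below the scheme up to an error multiplied by the exponential of a Riemann sum
    of [b' (`|z| + e)] along the scheme [z] ([solution_le_euler]), and the scheme
    is below every solution up to an error that vanishes with the step
    ([euler_le_solution]). So two solutions coincide on each path for which these
    Riemann sums stay bounded along a suitable choice of regularisations and
    steps ([solutions_le]).

    That almost every Brownian path has this property comes from a discrete
    version of Ito's formula. Let [F], called [potential] below, be the even
    function with [F 0 = 0] whose derivative is [b] on the right half-line, so
    that [F'' x = b' `|x|]. Adding to a point [z] a centred Gaussian variable of
    variance [h] increases the mean of [F] by at least a constant times
    [h * b' (`|z| + e)] when [h <= e ^+ 2] ([normal_law_gain]), while the drift
    part of an Euler step decreases it by at most a constant times [h]. Summing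
    over the steps, the expected Riemann sum is bounded in terms of the final mean
    of [F], uniformly in the regularisation and the step
    ([expected_gronwall_exponent_le]), and Fatou's lemma concludes
    ([gronwall_exponent_frequently_bounded]). The computation uses that a position of
    the scheme is independent of the next increment ([past_noise_indep]).

    Existence holds on every continuous path, by Peano's theorem
    ([solution_exists]). *)

(** * The drift and its regularisation *)

Record admissible_drift {R : realType} (b : R -> R) : Prop := AdmissibleDrift {
  drift0 : b 0 = 0 ;
  drift_continuous : continuous b ;
  drift_nondecreasing : {in `]0, +oo[ &, nondecreasing_fun b} ;
  drift_derivable : {in `]0, +oo[, forall x : R, derivable b x 1} ;
  derive1_drift_continuous : {in `]0, +oo[, continuous (derive1 b)} ;
  derive1_drift_nonincreasing : {in `]0, +oo[ &, nonincreasing_fun (derive1 b)} ;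
  drift_abs_le : forall x : R, b `|x| <= b (- `|x|) ;
  drift_nonincreasing : {in `]-oo, 0] &, nonincreasing_fun b} }.

Section drift.
Context {R : realType}.
Variable b : R -> R.
Hypothesis bP : admissible_drift b.
Let b0 := drift0 bP.
Let b_cont := drift_continuous bP.
Let b_nd := drift_nondecreasing bP.
Let b_derivable := drift_derivable bP.
Let b'_ni := derive1_drift_nonincreasing bP.
Let b_abs_le := drift_abs_le bP.
Let b_ni := drift_nonincreasing bP.

Let in_pos (x : R) : 0 < x -> x \in `]0, +oo[.
Proof. by move=> x0; rewrite in_itv/= x0. Qed.

Lemma drift_mean_value (x y : R) : 0 <= x -> x < y ->
  exists c, [/\ x < c, c < y & b y - b x = derive1 b c * (y - x)].
Proof.
move=> x0 xy; have [||c] := @MVT R b (derive1 b) x y xy.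
- move=> z; rewrite in_itv/= => /andP[xz _].
  rewrite derive1E; apply/derivableP/b_derivable/in_pos/(le_lt_trans x0 xz).
- exact: continuous_subspaceT.
- by rewrite in_itv/= => /andP[xc cy] ->; exists c.
Qed.

Lemma derive1_drift_antitone (x y : R) : 0 < x -> x <= y ->
  derive1 b y <= derive1 b x.
Proof.
by move=> x0 xy; apply: b'_ni => //; apply: in_pos => //; exact: lt_le_trans xy.
Qed.

(** A negative slope at [x] would, slopes being nonincreasing, make [b] decrease
    from [x] to [x + 1]. *)
Lemma derive1_drift_ge0 (x : R) : 0 < x -> 0 <= derive1 b x.
Proof.
move=> x0; have xx1 : x < x + 1 by rewrite ltrDl.
have [c [xc _]] := drift_mean_value (ltW x0) xx1.
rewrite addrAC subrr add0r mulr1 => E.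
apply: (@le_trans _ _ (derive1 b c)); last exact/derive1_drift_antitone/ltW.
rewrite -E subr_ge0; apply: b_nd; rewrite ?in_pos// ?ltW//.
exact: lt_trans xx1.
Qed.

Lemma drift_monotone (x y : R) : 0 <= x -> x <= y -> b x <= b y.
Proof.
move=> x0; rewrite le_eqVlt => /predU1P[->//|xy].
rewrite -subr_ge0; have [c [xc _ ->]] := drift_mean_value x0 xy.
rewrite mulr_ge0 ?subr_ge0 ?(ltW xy)//.
exact/derive1_drift_ge0/(le_lt_trans x0).
Qed.

Lemma drift_antitone (x y : R) : x <= y -> y <= 0 -> b y <= b x.
Proof.
move=> xy y0; apply: b_ni => //; rewrite in_itv/=//.
exact: le_trans y0.
Qed.

Lemma drift_opp_ge (x : R) : 0 <= x -> b x <= b (- x).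
Proof. by move=> x0; have := b_abs_le x; rewrite ger0_norm. Qed.

Lemma drift_ge0 (x : R) : 0 <= b x.
Proof.
rewrite -b0; have [x0|/ltW x0] := leP 0 x; first exact: drift_monotone.
exact: drift_antitone.
Qed.

Lemma drift_increment_le (x y : R) : 0 < x -> x <= y ->
  b y - b x <= derive1 b x * (y - x).
Proof.
move=> x0; rewrite le_eqVlt => /predU1P[->|xy]; first by rewrite !subrr mulr0.
have [c [xc _ ->]] := drift_mean_value (ltW x0) xy.
by rewrite ler_wpM2r ?subr_ge0 ?(ltW xy)// derive1_drift_antitone// ltW.
Qed.

Lemma drift_increment_ge (r x y : R) : 0 <= x -> x <= y -> y <= r ->
  derive1 b r * (y - x) <= b y - b x.
Proof.
move=> x0; rewrite le_eqVlt => /predU1P[->|xy yr]; first by rewrite !subrr mulr0.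
have [c [xc cy ->]] := drift_mean_value x0 xy.
rewrite ler_wpM2r ?subr_ge0 ?(ltW xy)// derive1_drift_antitone//.
  exact: le_lt_trans xc.
exact/ltW/(lt_le_trans cy).
Qed.

(** Concavity and [b 0 = 0]: the increment over an interval of length [x]
    starting at [y] is at most the increment over [`[0, x]]. *)
Lemma drift_subadditive (x y : R) : 0 <= x -> 0 <= y -> b (x + y) <= b x + b y.
Proof.
wlog xy : x y / x <= y => [H x0 y0|x0 y0].
  have [|/ltW] := leP x y => xy; first exact: H.
  by rewrite addrC (addrC (b x)) H.
move: x0 xy; rewrite le_eqVlt => /predU1P[<- _|x0 xy]; first by rewrite !add0r b0 add0r.
have yxy : y < x + y by rewrite ltrDr.
have [c [yc _]] := drift_mean_value y0 yxy; rewrite addrK => Ec.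
have [d [d0 dx]] := drift_mean_value (lexx 0) x0; rewrite b0 !subr0 => Ed.
rewrite -lerBlDr Ec Ed ler_wpM2r ?(ltW x0)// derive1_drift_antitone//.
exact/ltW/(lt_le_trans dx)/(le_trans xy)/ltW.
Qed.

Definition clip (N x : R) : R := Num.max (- N) (Num.min x N).

Lemma clip_id (N x : R) : `|x| <= N -> clip N x = x.
Proof.
rewrite ler_norml => /andP[Nx xN].
by rewrite /clip (min_idPl xN) (max_idPr Nx).
Qed.

Lemma clip_le (N x y : R) : x <= y -> clip N x <= clip N y.
Proof. by move=> xy; rewrite /clip; apply: le_max2 => //; apply: le_min2. Qed.

Lemma norm_clip (N x : R) : 0 <= N -> `|clip N x| <= N.
Proof.
move=> N0; rewrite ler_norml /clip le_max lexx/= ge_max.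
by rewrite ge_min lexx orbT andbT lerNl (le_trans _ N0)// oppr_le0.
Qed.

(** On the right half-line the graph of [b] is translated so as to skip the
    interval [`[0, e]], where [b'] may be unbounded. On the left half-line
    nothing needs to be changed: [b] is nonincreasing there, so it satisfies
    every one-sided Lipschitz bound. *)
Definition shift_drift (e x : R) : R :=
  b (Num.min x 0) + (b (Num.max x 0 + e) - b e).

Lemma shift_driftN (e x : R) : x <= 0 -> shift_drift e x = b x.
Proof.
by move=> x0; rewrite /shift_drift (min_idPl x0) (max_idPr x0) add0r subrr addr0.
Qed.

Lemma shift_driftP (e x : R) : 0 <= x -> shift_drift e x = b (x + e) - b e.
Proof.
by move=> x0; rewrite /shift_drift (min_idPr x0) (max_idPl x0) b0 add0r.
Qed.

Lemma clip_continuous (N : R) : continuous (clip N).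
Proof.
move=> x; apply: (@continuous_max R R (cst (- N)) (fun z => Num.min z N)).
  exact: cvg_cst.
by apply: (@continuous_min R R id (cst N)); [exact: cvg_id|exact: cvg_cst].
Qed.

Lemma shift_drift_continuous (e : R) : continuous (shift_drift e).
Proof.
move=> x; apply: cvgD.
  apply: continuous_comp; last exact: b_cont.
  by apply: (@continuous_min R R id (cst 0)); [exact: cvg_id|exact: cvg_cst].
apply: cvgB; last exact: cvg_cst.
apply: (@continuous_comp R R R (fun z => Num.max z 0 + e)); last exact: b_cont.
apply: cvgD; last exact: cvg_cst.
by apply: (@continuous_max R R id (cst 0)); [exact: cvg_id|exact: cvg_cst].
Qed.

Lemma shift_drift_le (e x : R) : 0 <= e -> shift_drift e x <= b x.
Proof.
move=> e0; have [x0|/ltW x0] := leP x 0; first by rewrite shift_driftN.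
by rewrite shift_driftP// lerBlDr drift_subadditive.
Qed.

Lemma shift_drift_ge (e x : R) : 0 <= e -> b x - b e <= shift_drift e x.
Proof.
move=> e0; have [x0|/ltW x0] := leP x 0.
  by rewrite shift_driftN// lerBlDr lerDl drift_ge0.
by rewrite shift_driftP// lerB// drift_monotone// lerDl.
Qed.

Lemma shift_drift_ge0 (e x : R) : 0 <= e -> 0 <= shift_drift e x.
Proof.
move=> e0; have [x0|/ltW x0] := leP x 0; first by rewrite shift_driftN// drift_ge0.
by rewrite shift_driftP// subr_ge0 drift_monotone// lerDr.
Qed.

(** The one-sided Lipschitz bound behind uniqueness. Its constant involves only
    the position [x] of the lower point. The delicate case is [x < 0 < y]: the
    drift at [x] dominates the drift at the mirror point [`|x|], so only the part
    of [`[x, y]] to the right of [`|x|] can contribute. *)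
Lemma shift_drift_increment_le (e x y : R) : 0 < e -> x <= y ->
  shift_drift e y - shift_drift e x <= derive1 b (`|x| + e) * (y - x).
Proof.
move=> e0 xy.
have key u v : 0 <= u -> u <= v ->
    shift_drift e v - shift_drift e u <= derive1 b (u + e) * (v - u).
  move=> u0 uv; rewrite !shift_driftP// ?(le_trans u0)//.
  have -> : b (v + e) - b e - (b (u + e) - b e) = b (v + e) - b (u + e) by lra.
  have -> : v - u = (v + e) - (u + e) by lra.
  by apply: drift_increment_le; [exact: ltr_wpDl|rewrite lerD2r].
have g0 : 0 <= derive1 b (`|x| + e) by apply: derive1_drift_ge0; rewrite ltr_wpDl.
have [x0|x0] := leP 0 x; first by rewrite ger0_norm// key.
have abs_le : shift_drift e `|x| <= shift_drift e x.
  apply: le_trans (shift_drift_le _ (ltW e0)) _.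
  rewrite shift_driftN ?(ltW x0)// ltr0_norm// -{2}[x]opprK.
  by rewrite drift_opp_ge// oppr_ge0 ltW.
have [y0|y0] := leP y 0.
  rewrite (@le_trans _ _ 0)//; last by rewrite mulr_ge0// subr_ge0.
  by rewrite subr_le0 !shift_driftN ?(ltW x0)// drift_antitone.
have [yx|xy'] := leP y `|x|.
  rewrite (@le_trans _ _ 0)//; last by rewrite mulr_ge0// subr_ge0.
  rewrite subr_le0 (le_trans _ abs_le)// !shift_driftP ?(ltW y0)// lerD2r.
  by apply: drift_monotone; rewrite ?addr_ge0 ?(ltW y0) ?(ltW e0)// lerD2r.
apply: (@le_trans _ _ (shift_drift e y - shift_drift e `|x|)); first by rewrite lerB.
apply: le_trans (key _ _ _ (ltW xy')) _ => //.
by rewrite ler_wpM2l// lerB// ler_norm.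
Qed.

(** Freezing the argument outside [`[- N, N]] makes the drift bounded, which
    gives the Euler schemes below a bounded distance to the noise. *)
Definition reg_drift (N e x : R) : R := shift_drift e (clip N x).

Lemma reg_drift_continuous (N e : R) : continuous (reg_drift N e).
Proof.
move=> x; apply: (@continuous_comp R R R (clip N) (shift_drift e)).
  exact: clip_continuous.
exact: shift_drift_continuous.
Qed.

Lemma reg_drift_ge0 (N e x : R) : 0 <= e -> 0 <= reg_drift N e x.
Proof. exact: shift_drift_ge0. Qed.

Lemma reg_drift_le_max (N e x : R) : 0 <= N -> 0 <= e -> reg_drift N e x <= b (- N).
Proof.
move=> N0 e0; apply: le_trans (shift_drift_le _ e0) _.
have := norm_clip x N0; rewrite ler_norml => /andP[l u].
have [y0|/ltW y0] := leP (clip N x) 0; first exact: drift_antitone.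
by apply: le_trans (drift_opp_ge N0); exact: drift_monotone.
Qed.

Lemma reg_drift_le (N e x : R) : 0 <= e -> `|x| <= N -> reg_drift N e x <= b x.
Proof. by move=> e0 xN; rewrite /reg_drift clip_id// shift_drift_le. Qed.

Lemma reg_drift_ge (N e x : R) : 0 <= e -> `|x| <= N -> b x - b e <= reg_drift N e x.
Proof. by move=> e0 xN; rewrite /reg_drift clip_id// shift_drift_ge. Qed.

(** Clipping only shortens increments, but for [x < - N] the point [clip N x] has
    a smaller norm than [x]; there the increment is nonpositive, since [- N] is a
    maximiser of the drift on [`[- N, N]]. *)
Lemma reg_drift_increment_le (N e x y : R) : 0 <= N -> 0 < e -> x <= y ->
  reg_drift N e y - reg_drift N e x <= derive1 b (`|x| + e) * (y - x).
Proof.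
move=> N0 e0 xy; rewrite /reg_drift.
have g0 : 0 <= derive1 b (`|x| + e) by apply: derive1_drift_ge0; rewrite ltr_wpDl.
have r0 : 0 <= derive1 b (`|x| + e) * (y - x) by rewrite mulr_ge0// subr_ge0.
have [xN|Nx] := leP x (- N).
  have -> : clip N x = - N.
    by rewrite /clip; apply/max_idPl; rewrite ge_min xN.
  apply: le_trans r0; rewrite subr_le0 [leRHS]shift_driftN ?oppr_le0//.
  exact: reg_drift_le_max N0 (ltW e0).
have [Nx'|xN] := leP N x.
  have cN z : N <= z -> clip N z = N.
    move=> Nz; rewrite /clip (min_idPr Nz); apply/max_idPr.
    by rewrite (le_trans _ N0)// oppr_le0.
  by rewrite !cN// ?subrr// (le_trans Nx').
have cx : clip N x = x by apply: clip_id; rewrite ler_norml !ltW.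
have cxy := clip_le N xy; rewrite cx in cxy.
rewrite cx; apply: le_trans (shift_drift_increment_le e0 cxy) _.
rewrite ler_wpM2l// lerB// /clip ge_max ge_min lexx andbT.
exact: le_trans (ltW Nx) xy.
Qed.

End drift.

(** * A discrete Gronwall inequality *)

Section discrete_gronwall.
Context {R : realType}.

(** Only the positive part of [D] matters: below zero nothing is known about the
    growth of [D], but the next value is at most [h * (B + a)], and the error
    [h * B] is paid once, not at each passage through zero. *)
Lemma discrete_gronwall (D g : nat -> R) (h B a : R) (n : nat) :
  0 <= h -> 0 <= B -> 0 <= a -> (forall j, 0 <= g j) -> D 0%N <= 0 ->
  (forall j, (j < n)%N -> 0 <= D j -> D j.+1 <= D j + h * (g j * D j + a)) ->
  (forall j, (j < n)%N -> D j < 0 -> D j.+1 <= h * (B + a)) ->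
  forall j, (j <= n)%N ->
    D j <= (h * B + j%:R * h * a) * expR (h * \sum_(i < j) g i).
Proof.
move=> h0 B0 a0 g0 D0 Dp Dn; elim=> [_|j IH jn].
  by rewrite big_ord0 mulr0 expR0 mulr1 mul0r mul0r addr0 (le_trans D0)// mulr_ge0.
have E0 m : 0 <= h * \sum_(i < m) g i by rewrite mulr_ge0// sumr_ge0.
have E1 m : 1 <= expR (h * \sum_(i < m) g i) by rewrite -expR0 ler_expR.
have hB0 : 0 <= h * B by rewrite mulr_ge0.
have ha0 : 0 <= h * a by rewrite mulr_ge0.
have jha0 : 0 <= j%:R * (h * a) by rewrite mulr_ge0.
have -> : j.+1%:R * h * a = j%:R * (h * a) + h * a.
  by rewrite -natr1; ring.
have [Dj|Dj] := leP 0 (D j); last first.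
  apply: le_trans (Dn _ jn Dj) _; rewrite mulrDr.
  apply: (@le_trans _ _ (h * B + (j%:R * (h * a) + h * a))).
    by rewrite lerD2l lerDr.
  by rewrite ler_peMr// !addr_ge0.
apply: le_trans (Dp _ jn Dj) _.
have -> : D j + h * (g j * D j + a) = (1 + h * g j) * D j + h * a by ring.
rewrite addrA [leRHS]mulrDl; apply: lerD; last by rewrite ler_peMr.
have -> : h * (\sum_(i < j.+1) g i) = h * g j + h * \sum_(i < j) g i.
  by rewrite big_ord_recr/= mulrDr addrC.
rewrite expRD mulrCA ler_pM//; first by rewrite addr_ge0// mulr_ge0.
  exact: expR_ge1Dx.
by rewrite mulrA; apply: IH; exact: ltnW.
Qed.

End discrete_gronwall.

(** * Integrals of continuous functions on a segment *)

Section segment_continuity.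
Context {R : realType}.

(** Heine's theorem. *)
Lemma continuous_segment_modulus (f : R -> R) (a c e : R) : 0 < e ->
  {within `[a, c], continuous f} ->
  exists2 d, 0 < d & forall r s, r \in `[a, c] -> s \in `[a, c] ->
    `|r - s| <= d -> `|f r - f s| <= e.
Proof.
move=> e0 /subspace_continuousP fC.
have := @segment_compact R a c.
move=> /(compact_near_coveringP _).1/(near_covering_withinP _).2.
pose P (d x : R) := forall s, s \in `[a, c] -> `|x - s| <= d -> `|f x - f s| <= e.
move=> /(_ R (0 : R)^'+ P _)[|d1 /= d10 H].
  move=> x xac.
  have /cvgrPdist_le/(_ (e / 2))[|r /= r0 xr] := fC x xac; first by rewrite divr_gt0.
  exists (ball x (r / 2), [set d | d < r / 2]) => /=.
    split; first by apply: nbhsx_ballx; rewrite divr_gt0.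
    exists (r / 2) => /=; first by rewrite divr_gt0.
    by move=> z /=; rewrite sub0r normrN => + z0; rewrite gtr0_norm.
  move=> [x' d] /= [xx' dr] x'ac s sac x's.
  have h1 : `|f x - f x'| <= e / 2.
    by apply: xr => //=; apply: lt_trans xx' _; lra.
  have h2 : `|f x - f s| <= e / 2.
    apply: xr => //=; apply: le_lt_trans (ler_distD x' _ _) _.
    move: xx'; rewrite /ball/= => xx'; lra.
  by apply: le_trans (ler_distD (f x) _ _) _; rewrite distrC; lra.
exists (d1 / 2); first by rewrite divr_gt0.
move=> r s rac sac rs; apply: (H (d1 / 2)) => //=.
  by rewrite sub0r normrN gtr0_norm ?divr_gt0//; lra.
by rewrite divr_gt0.
Qed.

Lemma within_continuous_comp (A : set R) (f g : R -> R) :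
  {within A, continuous f} -> continuous g -> {within A, continuous (g \o f)}.
Proof.
move=> fC gC x; apply: (@continuous_comp (subspace A) R R f g x); first exact: fC.
exact: gC.
Qed.

Lemma continuous_segment_bounded (f : R -> R) (a c : R) :
  {within `[a, c], continuous f} ->
  exists N : nat, forall r, r \in `[a, c] -> `|f r| <= N%:R.
Proof.
move=> fC.
have /compact_bounded[M [_ HM]] := continuous_compact fC (@segment_compact R a c).
exists (Num.truncn `|M + 1|).+1 => r rac.
apply: le_trans (_ : _ <= M + 1) _.
  by apply: HM; [rewrite ltrDl|exists r].
by apply: le_trans (ler_norm _) _; exact/ltW/truncnS_gt.
Qed.

End segment_continuity.

Section integral_increment.
Context {R : realType}.
Local Notation mu := (@lebesgue_measure R).

Lemma integrable_within_continuous (f : R -> R) (T s t : R) : 0 <= s -> t <= T ->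
  {within `[0, T], continuous f} -> mu.-integrable `[s, t] (EFin \o f).
Proof.
move=> s0 tT fC; apply: (@integrableS _ _ R mu `[0, T]) => //.
  move=> r /=; rewrite !in_itv/= => /andP[sr rt].
  by rewrite (le_trans s0 sr) (le_trans rt tT).
by apply: continuous_compact_integrable => //; exact: segment_compact.
Qed.

Lemma Rintegral_increment (f : R -> R) (T s t : R) : 0 <= s -> s <= t -> t <= T ->
  {within `[0, T], continuous f} ->
  \int[mu]_(r in `[0, t]) f r - \int[mu]_(r in `[0, s]) f r =
  \int[mu]_(r in `]s, t]) f r.
Proof.
move=> s0 st tT fC; apply: Rintegral_itvB.
- exact: integrable_within_continuous fC.
- by rewrite bnd_simp.
- by rewrite bnd_simp.
Qed.

Lemma Rintegral_increment_le (f : R -> R) (T s t c : R) :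
  0 <= s -> s <= t -> t <= T -> {within `[0, T], continuous f} ->
  (forall r, s <= r -> r <= t -> f r <= c) ->
  \int[mu]_(r in `[0, t]) f r - \int[mu]_(r in `[0, s]) f r <= c * (t - s).
Proof.
move=> s0 st tT fC fc; rewrite (Rintegral_increment s0 st tT fC).
have int_st : mu.-integrable `]s, t] (EFin \o f).
  apply: integrableS (integrable_within_continuous s0 tT fC) => //.
  exact: subset_itv_oc_cc.
apply: (@le_trans _ _ (\int[mu]_(r in `]s, t]) c)).
  apply: le_Rintegral => //.
    apply: integrableS (@integrable_within_continuous (cst c) T s t s0 tT _) => //.
      exact: subset_itv_oc_cc.
    by apply: continuous_subspaceT => ?; exact: cvg_cst.
  by move=> r; rewrite /= in_itv/= => /andP[sr rt]; apply: fc => //; exact: ltW.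
rewrite Rintegral_cst//= lebesgue_measure_itv/= lte_fin.
move: st; rewrite le_eqVlt => /predU1P[->|->]; last by rewrite EFinN -EFinB.
by rewrite ltxx subrr.
Qed.

Lemma Rintegral_increment_ge (f : R -> R) (T s t c : R) :
  0 <= s -> s <= t -> t <= T -> {within `[0, T], continuous f} ->
  (forall r, s <= r -> r <= t -> c <= f r) ->
  c * (t - s) <= \int[mu]_(r in `[0, t]) f r - \int[mu]_(r in `[0, s]) f r.
Proof.
move=> s0 st tT fC fc; rewrite (Rintegral_increment s0 st tT fC).
have int_st : mu.-integrable `]s, t] (EFin \o f).
  apply: integrableS (integrable_within_continuous s0 tT fC) => //.
  exact: subset_itv_oc_cc.
apply: (@le_trans _ _ (\int[mu]_(r in `]s, t]) c)); last first.
  apply: le_Rintegral => //.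
    apply: integrableS (@integrable_within_continuous (cst c) T s t s0 tT _) => //.
      exact: subset_itv_oc_cc.
    by apply: continuous_subspaceT => ?; exact: cvg_cst.
  by move=> r; rewrite /= in_itv/= => /andP[sr rt]; apply: fc => //; exact: ltW.
rewrite Rintegral_cst//= lebesgue_measure_itv/= lte_fin.
move: st; rewrite le_eqVlt => /predU1P[->|->]; last by rewrite EFinN -EFinB.
by rewrite ltxx subrr.
Qed.

Lemma Rintegral_itv00 (f : R -> R) : \int[mu]_(r in `[0, 0]) f r = 0.
Proof. by rewrite set_itv1 Rintegral_set1. Qed.

End integral_increment.

(** * A convex primitive of the drift *)

Section potential.
Context {R : realType}.
Variable b : R -> R.
Hypothesis bP : admissible_drift b.
Let b0 := drift0 bP.
Let b_cont := drift_continuous bP.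
Local Notation mu := (@lebesgue_measure R).

Let b_mono := drift_monotone bP.
Let b_ge0 := drift_ge0 bP.
Let b_incr_ge := drift_increment_ge bP.

(** The potential is the even function whose second derivative is [b' `|x|], and
    [slope] is its derivative. It is the test function to which a discrete form
    of Ito's formula is applied: Brownian noise makes its mean grow at the rate
    [b' `|x| / 2]. As [b'] may be unbounded near zero, the second derivative is
    used only through the inequality [slope_increment_ge]. *)
Definition potential (x : R) : R := \int[mu]_(r in `[0, `|x|]) b r.
Definition slope (x : R) : R := Num.sg x * b `|x|.

Lemma potential0 : potential 0 = 0.
Proof. by rewrite /potential normr0 Rintegral_itv00. Qed.

Lemma potential_ge0 (x : R) : 0 <= potential x.
Proof. exact: Rintegral_ge0. Qed.

Lemma norm_slope (x : R) : `|slope x| = b `|x|.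
Proof.
rewrite /slope normrM normr_sg (ger0_norm (b_ge0 _)).
by have [->|x0] := eqVneq x 0; rewrite ?normr0 ?b0 ?mulr0// mul1r.
Qed.

(** Convexity. For points of opposite signs it follows from the convexity on the
    half-line, because the potential depends on [`|x|] only and
    [Num.sg x * y <= `|y|]. *)
Lemma potential_tangent (x y : R) :
  potential x + slope x * (y - x) <= potential y.
Proof.
apply: (@le_trans _ _ (potential x + b `|x| * (`|y| - `|x|))).
  rewrite lerD2l /slope mulrC mulrA [leRHS]mulrC ler_wpM2r// mulrBl.
  rewrite ![_ * Num.sg x]mulrC -(normrEsg x) lerD2r.
  apply: le_trans (ler_norm _) _; rewrite normrM normr_sg.
  by case: (x != 0); rewrite ?mul1r// mul0r.
have C T : {within `[0, T], continuous b} by exact: continuous_subspaceT.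
rewrite -lerBrDl /potential.
have [xy|/ltW yx] := leP `|x| `|y|.
  apply: (@Rintegral_increment_ge _ _ `|y|) => // r xr _.
  exact: b_mono.
rewrite -lerN2 opprB -mulrN opprB.
apply: (@Rintegral_increment_le _ _ `|x|) => // r yr rx.
by apply: b_mono => //; exact: le_trans yr.
Qed.

Lemma potential_le (x : R) : potential x <= `|x| * b `|x|.
Proof.
have := potential_tangent x 0; rewrite potential0 sub0r mulrN subr_le0.
move=> /le_trans; apply; apply: le_trans (ler_norm _) _.
by rewrite normrM norm_slope mulrC.
Qed.

Lemma potential_continuous : continuous potential.
Proof.
have loc x y : `|y| <= `|x| + 1 ->
    `|potential y - potential x| <= b (`|x| + 1) * `|y - x|.
  move=> yx; rewrite ler_norml lerNl opprB; apply/andP; split.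
    rewrite lerBlDr; have tangent := potential_tangent x y.
    rewrite -(lerD2l (b (`|x| + 1) * `|y - x|)) in tangent.
    apply: le_trans tangent.
    rewrite addrCA lerDl -lerBlDr sub0r; apply: le_trans (ler_norm _) _.
    rewrite normrN normrM norm_slope ler_wpM2r//.
    by apply: b_mono => //; rewrite lerDl.
  rewrite lerBlDr.
  have tangent := potential_tangent y x.
  rewrite -(lerD2l (b (`|x| + 1) * `|y - x|)) in tangent.
  apply: le_trans tangent.
  rewrite addrCA lerDl -lerBlDr sub0r; apply: le_trans (ler_norm _) _.
  rewrite normrN normrM norm_slope distrC ler_wpM2r//.
  by apply: b_mono.
move=> x; have near_dist d : 0 < d -> \forall y \near x, `|x - y| <= d.
  by move=> d0; exists d => //= y /ltW.
apply/cvgrPdist_le => e e0.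
near=> y.
have yx1 : `|x - y| <= 1 by near: y; exact: near_dist.
have yx : `|x - y| <= e / (b (`|x| + 1) + 1).
  by near: y; apply: near_dist; rewrite divr_gt0// ltr_wpDl.
rewrite distrC; apply: le_trans (loc x y _) _.
  by rewrite -lerBlDl (le_trans (lerB_dist _ _))// distrC.
apply: (@le_trans _ _ ((b (`|x| + 1) + 1) * `|y - x|)).
  by rewrite ler_wpM2r// lerDl.
by rewrite mulrC -ler_pdivlMr ?ltr_wpDl// distrC.
Unshelve. all: by end_near. Qed.

(** Strong monotonicity, with the smallest slope of [b] on [`]0, r]] as constant,
    also across zero where [slope] is odd. *)
Lemma slope_increment_ge (r x y : R) : x <= y -> `|x| <= r -> `|y| <= r -> 0 < r ->
  derive1 b r * (y - x) <= slope y - slope x.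
Proof.
move=> xy xr yr r0.
have pos u : 0 <= u -> slope u = b u.
  rewrite le_eqVlt => /predU1P[<-|u0]; first by rewrite /slope normr0 b0 mulr0.
  by rewrite /slope gtr0_sg// mul1r gtr0_norm.
have neg u : u <= 0 -> slope u = - b (- u).
  rewrite le_eqVlt => /predU1P[->|u0].
    by rewrite /slope normr0 oppr0 b0 mulr0 oppr0.
  by rewrite /slope ltr0_sg// mulN1r ltr0_norm.
move: xr yr; rewrite !ler_norml => /andP[rx xr] /andP[ry yr].
have [x0|/ltW x0] := leP 0 x.
  by rewrite !pos ?(le_trans x0)// b_incr_ge.
have [y0|/ltW y0] := leP y 0.
  have := b_incr_ge (x := - y) (y := - x) (r := r).
  rewrite oppr_ge0 lerN2 lerNl => /(_ y0 xy rx).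
  by rewrite !neg// opprK addrC (addrC (- b _)) opprK.
have h1 := b_incr_ge (lexx 0) y0 yr.
have h2 : derive1 b r * (- x - 0) <= b (- x) - b 0.
  by apply: b_incr_ge; rewrite ?oppr_ge0// lerNl.
rewrite pos// neg// opprK.
move: h1 h2; rewrite b0 !subr0 => h1 h2.
by rewrite mulrBr -mulrN; exact: lerD.
Qed.

(** A second-order Taylor bound obtained without second derivatives: apply the
    tangent inequality on each half of the segment from [u] to [u + z]; on the
    second half the slope has already increased. *)
Lemma potential_gain (s u z : R) : 0 < s -> `|z| <= s ->
  potential u + slope u * z + derive1 b (`|u| + s) * (z ^+ 2 / 4) <= potential (u + z).
Proof.
move=> s0 zs.
have t1 := potential_tangent u (u + z / 2).
have t2 := potential_tangent (u + z / 2) (u + z).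
have zE : u + z / 2 - u = z / 2 by lra.
have zE' : u + z - (u + z / 2) = z / 2 by lra.
rewrite zE in t1; rewrite zE' in t2.
have r0 : 0 < `|u| + s by rewrite ltr_wpDl.
have ur : `|u| <= `|u| + s by rewrite lerDl ltW.
have uzr : `|u + z / 2| <= `|u| + s.
  apply: le_trans (ler_normD _ _) _.
  rewrite lerD2l normrM (_ : `|2^-1| = 2^-1); last by rewrite ger0_norm.
  by have := normr_ge0 z; lra.
have [z0|/ltW z0] := leP 0 z.
  have := @slope_increment_ge (`|u| + s) u (u + z / 2).
  rewrite zE lerDl divr_ge0// => /(_ isT ur uzr r0) g.
  have : 0 <= (slope (u + z / 2) - slope u -
      derive1 b (`|u| + s) * (z / 2)) * (z / 2).
    by rewrite mulr_ge0 ?divr_ge0// subr_ge0.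
  nra.
have := @slope_increment_ge (`|u| + s) (u + z / 2) u.
rewrite -lerBrDl subrr mulr_le0_ge0// => /(_ isT uzr ur r0) g.
have : 0 <= (slope u - slope (u + z / 2) -
    derive1 b (`|u| + s) * (u - (u + z / 2))) * (- (z / 2)).
  by rewrite mulr_ge0 ?subr_ge0// oppr_ge0 mulr_le0_ge0.
nra.
Qed.

End potential.

(** * Euler schemes squeezed between solutions *)

Section euler_comparison.
Context {R : realType}.

Fixpoint euler (beta : R -> R) (h : R) (xi : nat -> R) (j : nat) : R :=
  if j is j'.+1 then euler beta h xi j' + h * beta (euler beta h xi j') + xi j'
  else 0.

Variable b : R -> R.
Hypothesis bP : admissible_drift b.
Let b0 := drift0 bP.
Let b_cont := drift_continuous bP.
Let b_ge0 := drift_ge0 bP.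
Let b'_ge0 := derive1_drift_ge0 bP.
Let b'_anti := derive1_drift_antitone bP.
Let reg_ge0 := reg_drift_ge0 bP.
Let reg_max := reg_drift_le_max bP.
Let reg_le := reg_drift_le bP.
Let reg_ge := reg_drift_ge bP.
Let reg_incr := reg_drift_increment_le bP.

Variables (T : R) (omega : R -> R).
Hypothesis T_gt0 : 0 < T.
Hypothesis omega0 : omega 0 = 0.

Definition step (m : nat) : R := T / m%:R.
Definition noise (m j : nat) : R := omega (step m * j.+1%:R) - omega (step m * j%:R).

Let step_ge0 m : 0 <= step m.
Proof. by rewrite /step divr_ge0 ?ler0n// ltW. Qed.

Let grid_ge0 m j : 0 <= step m * j%:R.
Proof. by rewrite mulr_ge0// ler0n. Qed.

Let grid_le m j : (j <= m)%N -> step m * j%:R <= T.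
Proof.
case: m => [|m jm]; first by rewrite /step invr0 mulr0 mul0r ltW.
by rewrite /step mulrAC ler_pdivrMr ?ltr0n// ler_wpM2l ?(ltW T_gt0)// ler_nat.
Qed.

Let grid_in m j : (j <= m)%N -> step m * j%:R \in `[0, T].
Proof. by move=> jm; rewrite in_itv/= grid_ge0 grid_le. Qed.

Section one_solution.
Variables (y : R -> R) (N : R).
Hypothesis N_ge0 : 0 <= N.
Hypothesis y_sol : is_solution T b omega y.
Hypothesis y_le : forall r, r \in `[0, T] -> `|y r| <= N.

Lemma solution_start : y 0 = 0.
Proof.
case: y_sol => _ ->; first by rewrite Rintegral_itv00 add0r.
by rewrite in_itv/= lexx ltW.
Qed.

Lemma drift_solution_continuous : {within `[0, T], continuous (b \o y)}.
Proof.
by case: y_sol => yC _; exact: within_continuous_comp.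
Qed.

(** On a short step a solution moves like one step of the Euler scheme of [b]. *)
Lemma solution_increment (m j : nat) (e : R) : (j < m)%N ->
  (forall r s, r \in `[0, T] -> s \in `[0, T] -> `|r - s| <= step m ->
    `|b (y r) - b (y s)| <= e) ->
  `|y (step m * j.+1%:R) - y (step m * j%:R) - step m * b (y (step m * j%:R)) - noise m j|
  <= step m * e.
Proof.
move=> jm close; set s := step m * j%:R; set t := step m * j.+1%:R.
have st : t - s = step m by rewrite /t /s -natr1 mulrDr mulr1 addrAC subrr add0r.
have s0 : 0 <= s by exact: grid_ge0.
have tT : t <= T by exact: grid_le.
have st' : s <= t by rewrite -subr_ge0 st.
have near r : s <= r -> r <= t -> `|b (y r) - b (y s)| <= e.
  move=> sr rt; apply: close.
  - by rewrite in_itv/= (le_trans s0 sr) (le_trans rt tT).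
  - by apply: grid_in; exact: ltnW.
  - by rewrite ger0_norm ?subr_ge0// -st lerD2r.
case: y_sol => yC yE.
rewrite !yE ?grid_in// 1?ltnW//.
set I1 := (\int[_]_(_ in _) _); set I2 := (\int[_]_(_ in _) _).
rewrite /noise -/s -/t.
have -> : I1 + omega t - (I2 + omega s) - step m * b (I2 + omega s) - (omega t - omega s)
        = I1 - I2 - step m * b (I2 + omega s) by ring.
have -> : I2 + omega s = y s by rewrite yE// grid_in// ltnW.
have up : I1 - I2 <= (b (y s) + e) * (t - s).
  apply: (Rintegral_increment_le s0 st' tT drift_solution_continuous) => r sr rt.
  by have := near r sr rt; rewrite ler_norml /= => /andP[]; lra.
have lo : (b (y s) - e) * (t - s) <= I1 - I2.
  apply: (Rintegral_increment_ge s0 st' tT drift_solution_continuous) => r sr rt.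
  by have := near r sr rt; rewrite ler_norml /= => /andP[]; lra.
by rewrite st in up lo; rewrite ler_norml; apply/andP; split; nra.
Qed.

Section one_grid.
Variables (m : nat) (e eta : R).
Hypothesis e_gt0 : 0 < e.
Hypothesis eta_ge0 : 0 <= eta.
Hypothesis close : forall r s, r \in `[0, T] -> s \in `[0, T] ->
  `|r - s| <= step m -> `|b (y r) - b (y s)| <= eta.
Local Notation Z := (euler (reg_drift b N e) (step m) (noise m)).

(** Solutions lie below the scheme, up to an error whose exponential factor is
    governed by the points visited by the scheme itself, so that it can be
    estimated in the mean without knowing anything about the solution. *)
Lemma solution_le_euler (j : nat) : (j <= m)%N ->
  y (step m * j%:R) - Z j <=
  (step m * b (- N) + j%:R * step m * (eta + b e)) *
  expR (step m * \sum_(i < j) derive1 b (`|Z i| + e)).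
Proof.
have h0 := step_ge0 m.
apply: (@discrete_gronwall _ (fun j => y (step m * j%:R) - Z j)
  (fun i => derive1 b (`|Z i| + e))) => //.
- by rewrite addr_ge0.
- by move=> i; apply: b'_ge0; rewrite ltr_wpDl.
- by rewrite mulr0 solution_start subr0.
- move=> i im D0 /=.
  have := solution_increment im close; rewrite ler_norml => /andP[_ up].
  have ri := reg_ge (ltW e_gt0) (y_le (grid_in (ltnW im))).
  have zy : Z i <= y (step m * i%:R) by rewrite -subr_ge0.
  have := reg_incr N_ge0 e_gt0 zy.
  nra.
- move=> i im D0 /=.
  have := solution_increment im close; rewrite ler_norml => /andP[_ up].
  have ri := reg_ge (ltW e_gt0) (y_le (grid_in (ltnW im))).
  have := reg_max (y (step m * i%:R)) N_ge0 (ltW e_gt0).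
  have := reg_ge0 N (Z i) (ltW e_gt0).
  nra.
Qed.

(** Conversely the scheme lies below every solution, because its drift is
    smaller. The exponent contains the one-sided Lipschitz constant [derive1 b e],
    which may blow up as [e] tends to zero; but for fixed [e] the error vanishes
    with the step. *)
Lemma euler_le_solution (j : nat) : (j <= m)%N ->
  Z j - y (step m * j%:R) <=
  (step m * b (- N) + j%:R * step m * eta) * expR (step m * (j%:R * derive1 b e)).
Proof.
have h0 := step_ge0 m.
have -> : j%:R * derive1 b e = \sum_(i < j) derive1 b e.
  by rewrite sumr_const card_ord mulr_natl.
apply: (@discrete_gronwall _ (fun j => Z j - y (step m * j%:R))
  (fun i => derive1 b e)) => //.
- by move=> i; exact: b'_ge0.
- by rewrite mulr0 solution_start subr0.
- move=> i im D0 /=.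
  have := solution_increment im close; rewrite ler_norml => /andP[lo _].
  have ri := reg_le (ltW e_gt0) (y_le (grid_in (ltnW im))).
  have yz : y (step m * i%:R) <= Z i by rewrite -subr_ge0.
  have inc := reg_incr N_ge0 e_gt0 yz.
  have lip : derive1 b (`|y (step m * i%:R)| + e) * (Z i - y (step m * i%:R))
      <= derive1 b e * (Z i - y (step m * i%:R)).
    by rewrite ler_wpM2r// b'_anti// lerDr.
  nra.
- move=> i im D0 /=.
  have := solution_increment im close; rewrite ler_norml => /andP[lo _].
  have := reg_max (Z i) N_ge0 (ltW e_gt0).
  have := b_ge0 (y (step m * i%:R)).
  nra.
Qed.

End one_grid.
End one_solution.

(** The exponent of [solution_le_euler] at the final time, a Riemann sum for the
    integral of [b' (`|x s| + e)]. *)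
Definition gronwall_exponent (N e : R) (m : nat) : R :=
  step m * \sum_(i < m)
    derive1 b (`|euler (reg_drift b N e) (step m) (noise m) i| + e).

Lemma gronwall_exponent_ge0 (N e : R) (m : nat) : 0 < e -> 0 <= gronwall_exponent N e m.
Proof.
move=> e0; rewrite mulr_ge0// sumr_ge0// => i _.
by apply: b'_ge0; rewrite ltr_wpDl.
Qed.

Let b_small (d : R) : 0 < d ->
  exists n0 : nat, forall n, (n0 <= n)%N -> b n.+1%:R^-1 <= d.
Proof.
move=> d0; have /cvgrPdist_le/(_ d d0)[r /= r0 H] := @b_cont (0 : R).
exists (Num.truncn r^-1) => n n0n.
have : `|b 0 - b n.+1%:R^-1| <= d.
  apply: H => /=; rewrite sub0r normrN gtr0_norm ?invr_gt0 ?ltr0n//.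
  rewrite invf_plt ?posrE ?ltr0n//; apply: lt_le_trans (truncnS_gt _) _.
  by rewrite ler_nat.
by rewrite b0 sub0r normrN; apply: le_trans; exact: ler_norm.
Qed.

Lemma step_small (d : R) : 0 < d -> exists m0 : nat, forall m, (m0 <= m)%N -> step m <= d.
Proof.
move=> d0; exists (Num.truncn (T / d)).+1 => m m0m.
have m_gt0 : (0 < m)%N by exact: leq_trans m0m.
rewrite /step ler_pdivrMr ?ltr0n// mulrC -ler_pdivrMr//.
by apply/ltW/(lt_le_trans (truncnS_gt _)); rewrite ler_nat.
Qed.

(** If the exponents stay bounded for arbitrarily small regularisations and then
    arbitrarily small steps, any solution [y] lies below the schemes and the
    schemes lie below any solution [x], up to errors that vanish. *)
Lemma solutions_le (x y : R -> R) :
  (forall N : nat, exists K : R, forall n0, exists2 n, (n0 <= n)%N &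
    forall m0, exists2 m, (m0 <= m)%N & gronwall_exponent N%:R n.+1%:R^-1 m <= K) ->
  is_solution T b omega x -> is_solution T b omega y ->
  forall t, t \in `[0, T] -> y t <= x t.
Proof.
move=> exponent_bnd solx soly t tT; apply/ler_addgt0Pr => eps eps0.
have [[xC _] [yC _]] := (solx, soly).
have [Nx xN] := continuous_segment_bounded xC.
have [Ny yN] := continuous_segment_bounded yC.
pose N := maxn Nx Ny.
have {}xN r : r \in `[0, T] -> `|x r| <= N%:R.
  by move=> /xN/le_trans; apply; rewrite ler_nat leq_maxl.
have {}yN r : r \in `[0, T] -> `|y r| <= N%:R.
  by move=> /yN/le_trans; apply; rewrite ler_nat leq_maxr.
have [K HK] := exponent_bnd N.
have EK0 : 0 < expR K by exact: expR_gt0.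
(* First the regularisation is chosen, then the step: the factor [L] below
   depends on [e]. *)
have [|n0 n0P] := @b_small (eps / (8 * T * expR K)).
  by rewrite divr_gt0// mulr_gt0// mulr_gt0.
have [n /n0P bn HKn] := HK n0; set e := n.+1%:R^-1 in bn HKn.
have e0 : 0 < e by rewrite invr_gt0 ltr0n.
pose L := expR (T * derive1 b e); have L0 : 0 < L by exact: expR_gt0.
pose M := expR K + L; have M0 : 0 < M by rewrite addr_gt0.
pose eta := Num.min (eps / 4) (eps / (8 * T * M)).
have eta0 : 0 < eta by rewrite lt_min !divr_gt0// !mulr_gt0.
have [d1 d10 d1P] := continuous_segment_modulus eta0 (drift_solution_continuous solx).
have [d2 d20 d2P] := continuous_segment_modulus eta0 (drift_solution_continuous soly).
have [d3 d30 d3P] := continuous_segment_modulus eta0 xC.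
have [d4 d40 d4P] := continuous_segment_modulus eta0 yC.
pose B := b (- N%:R).
have B0 : 0 <= B by exact: b_ge0.
pose d := Num.min (Num.min (Num.min d1 d2) (Num.min d3 d4)) (eps / (8 * (B + 1) * M)).
have B10 : 0 < B + 1 by rewrite ltr_wpDl.
have d0 : 0 < d by rewrite !lt_min d10 d20 d30 d40 divr_gt0// !mulr_gt0.
have [m0 m0P] := step_small d0.
have [m m0m Km] := HKn (maxn m0 1); move: m0m; rewrite geq_max => /andP[/m0P hd m_gt0].
move: hd; rewrite !le_min => /andP[/andP[/andP[hd1 hd2] /andP[hd3 hd4]] hd5].
have h0 : 0 < step m by rewrite divr_gt0// ltr0n.
pose j := Num.truncn (t / step m).
move: (tT); rewrite in_itv/= => /andP[t0 tT'].
have /andP[jt tj] := truncn_itv (divr_ge0 t0 (ltW h0)); rewrite -/j in jt tj.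
rewrite ler_pdivlMr// mulrC in jt; rewrite ltr_pdivrMr// mulrC in tj.
have jm : (j <= m)%N.
  rewrite -(ler_nat R) -(ler_pM2l h0); apply: le_trans jt _.
  by rewrite /step divfK// pnatr_eq0 -lt0n.
have jT : step m * j%:R \in `[0, T] by exact: grid_in.
have tjh : `|t - step m * j%:R| <= step m.
  rewrite ger0_norm ?subr_ge0// lerBlDl; apply: le_trans (ltW tj) _.
  by rewrite -natr1 mulrDr mulr1.
have xt := d3P _ _ tT jT (le_trans tjh hd3).
have yt := d4P _ _ tT jT (le_trans tjh hd4).
have := solution_le_euler (ler0n _ N) soly yN e0 (ltW eta0)
  (fun r s rT sT rs => d2P r s rT sT (le_trans rs hd2)) jm.
have := euler_le_solution (ler0n _ N) solx xN e0 (ltW eta0)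
  (fun r s rT sT rs => d1P r s rT sT (le_trans rs hd1)) jm.
set Z := euler _ _ _ j; rewrite -/B.
set y' := y (step m * j%:R) in yt *; set x' := x (step m * j%:R) in xt *.
have jh : j%:R * step m <= T by rewrite mulrC; exact: le_trans tT'.
have jh0 : 0 <= j%:R * step m by rewrite mulr_ge0// ltW.
have E1 : expR (step m * (j%:R * derive1 b e)) <= L.
  rewrite ler_expR mulrA (mulrC (step m)) ler_wpM2r//.
  exact: b'_ge0.
pose G i := derive1 b (`|euler (reg_drift b N%:R e) (step m) (noise m) i| + e).
have E2 : expR (step m * \sum_(i < j) G i) <= expR K.
  rewrite ler_expR; apply: le_trans Km; rewrite ler_wpM2l ?(ltW h0)//.
  rewrite (big_ord_widen _ G jm).
  rewrite big_mkcond/=; apply: ler_sum => i _; case: ifP => // _.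
  by apply: b'_ge0; rewrite ltr_wpDl.
move=> D1 D2.
have be0 := b_ge0 e.
have A1 : Z - x' <= (step m * B + T * eta) * L.
  apply: le_trans D1 _; apply: ler_pM => //.
  - by rewrite addr_ge0// mulr_ge0// ltW.
  - by rewrite lerD2l ler_wpM2r// ltW.
have A2 : y' - Z <= (step m * B + T * (eta + b e)) * expR K.
  apply: le_trans D2 _; apply: ler_pM => //.
  - by rewrite addr_ge0// mulr_ge0// ?addr_ge0// ltW.
  - by rewrite lerD2l ler_wpM2r// addr_ge0// ltW.
have Q1 : step m * B * M <= eps / 8.
  apply: (@le_trans _ _ (step m * ((B + 1) * M))).
    rewrite -mulrA ler_wpM2l ?(ltW h0)// ler_wpM2r ?(ltW M0)//.
    by rewrite lerDl.
  move: hd5; rewrite ler_pdivlMr ?mulr_gt0//.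
  by rewrite ler_pdivlMr// => ?; nra.
have etaM : eta <= eps / (8 * T * M) by rewrite ge_min lexx orbT.
have eta4 : eta <= eps / 4 by rewrite ge_min lexx.
have Q2 : T * eta * M <= eps / 8.
  by move: etaM; rewrite ler_pdivlMr ?mulr_gt0// ler_pdivlMr// => ?; nra.
have Q3 : T * b e * expR K <= eps / 8.
  by move: bn; rewrite ler_pdivlMr ?mulr_gt0// ler_pdivlMr// => ?; nra.
have A3 : y' - x' <= eps / 8 + eps / 8 + eps / 8.
  have -> : y' - x' = (y' - Z) + (Z - x') by ring.
  apply: le_trans (lerD A2 A1) _.
  have -> : (step m * B + T * (eta + b e)) * expR K +
      (step m * B + T * eta) * L =
    step m * B * M + T * eta * M + T * b e * expR K by rewrite /M; ring.
  by rewrite !lerD.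
move: xt yt; rewrite !ler_norml => /andP[? ?] /andP[? ?].
lra.
Qed.

End euler_comparison.

(** * Independence of the past and the next increment *)

Section independence.
Local Open Scope ereal_scope.
Context {d : measure_display} {Omega : measurableType d} {R : realType}.
Variable P : probability Omega R.

Lemma measurable_preimage {d' : measure_display} {T : measurableType d'}
  (X : {mfun Omega >-> T}) (A : set T) : measurable A -> measurable (X @^-1` A).
Proof. by move=> mA; rewrite -[X in measurable X]setTI; exact: measurable_funPT. Qed.

Lemma mfun_of_measurable {d' : measure_display} {T : measurableType d'}
    (f : Omega -> T) : measurable_fun [set: Omega] f ->
  exists g : {mfun Omega >-> T}, g = f :> (Omega -> T).
Proof.
move=> mf; pose m := isMeasurableFun.Build _ _ _ _ f mf.
pose g : {mfun Omega >-> T} := HB.pack f m.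
by exists g.
Qed.

(** Independence is inherited from rectangles to all events of the pair, also
    jointly with a third event [H]: given [H], the law of the pair agrees with
    the product of the laws on rectangles, hence everywhere. *)
Lemma joint_law_product (X Y : {mfun Omega >-> R}) (H : set Omega) :
  measurable H ->
  (forall A B, measurable A -> measurable B ->
    P (X @^-1` A `&` Y @^-1` B `&` H) = P (X @^-1` A) * P (Y @^-1` B) * P H) ->
  forall E : set (R * R), measurable E ->
    P ((fun w => (X w, Y w)) @^-1` E `&` H) =
    (distribution P X \x distribution P Y) E * P H.
Proof.
move=> mH XYH E mE.
have [XY XYE] :=
  mfun_of_measurable (measurable_fun_pair (measurable_funPT X) (measurable_funPT Y)).
have mXYE := measurable_preimage XY mE; rewrite XYE in mXYE.
have PHfin : P H \is a fin_num by exact: fin_num_measure.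
have [PH0|PH0] := eqVneq (P H) 0.
  rewrite PH0 mule0; apply/eqP; rewrite eq_le measure_ge0 andbT -PH0.
  by apply: le_measure; rewrite ?inE//; exact: measurableI.
have r0 : (0 <= (fine (P H))^-1)%R by rewrite invr_ge0 fine_ge0.
pose m' : measure _ R := mscale (NngNum r0) (pushforward (mrestr P mH) XY).
rewrite (@product_measure_unique _ _ _ _ _ _ _ (m' (measurable_funPT XY)))//=; last first.
  move=> A B mA mB; rewrite /m' /mscale /= /pushforward /mrestr XYE.
  have -> : (fun w => (X w, Y w)) @^-1` (A `*` B) = X @^-1` A `&` Y @^-1` B by [].
  rewrite XYH// muleC -muleA -[X in _ * (X * _)](fineK PHfin) -EFinM.
  by rewrite divff ?mule1// fine_eq0.
rewrite /m' /mscale /= /pushforward /mrestr XYE.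
rewrite muleAC -[X in _ = _ * X * _](fineK PHfin) -EFinM mulVf ?mul1e//.
by rewrite fine_eq0.
Qed.


Lemma ge0_integral_joint_law (X Y : {mfun Omega >-> R}) (f : R * R -> \bar R) :
  (forall A B, measurable A -> measurable B ->
    P (X @^-1` A `&` Y @^-1` B) = P (X @^-1` A) * P (Y @^-1` B)) ->
  measurable_fun setT f -> (forall z, 0 <= f z) ->
  \int[P]_w f (X w, Y w) = \int[distribution P X]_x \int[distribution P Y]_y f (x, y).
Proof.
move=> XY mf f0.
have mXY := measurable_fun_pair (measurable_funPT X) (measurable_funPT Y).
have law E : measurable E ->
    P ((fun w => (X w, Y w)) @^-1` E) = (distribution P X \x distribution P Y) E.
  move=> mE; rewrite -[in LHS](setIT (_ @^-1` _)).
  rewrite joint_law_product// ?probability_setT ?mule1// => A B mA mB.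
  by rewrite setIT mule1 XY.
rewrite -(fubini_tonelli1 f)//.
transitivity (\int[pushforward P (fun w => (X w, Y w))]_z f z).
  by rewrite ge0_integral_pushforward.
apply: eq_measure_integral => E mE _.
by rewrite /= -law.
Qed.

Section past_and_future.
Variables (m : nat) (X : nat -> {mfun Omega >-> R}).
Hypothesis X_indep : @independent_RVs d Omega R P _ (fun i : 'I_m => X i).

(** Rectangles suffice: these events are stable under intersection and generate
    the sigma-algebra of the increments of rank at least [j]. *)
Definition future (j : nat) (A : 'I_m -> set R) : set Omega :=
  \bigcap_(i in [set` [set i : 'I_m | (j <= i)%N]%SET]) (X i @^-1` A i).

Lemma futureS (j : nat) (jm : (j < m)%N) (A : 'I_m -> set R) :
  future j A = X j @^-1` A (Ordinal jm) `&` future j.+1 A.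
Proof.
apply/seteqP; split=> [w Aw|w [Ajw Aw] i].
  split; first by apply: (Aw (Ordinal jm)); rewrite /= inE /=.
  by move=> i /=; rewrite inE => ji; apply: Aw; rewrite /= inE ltnW.
rewrite /= inE leq_eqVlt => /orP[/eqP ji|ji]; last by apply: Aw; rewrite /= inE.
have <- : Ordinal jm = i by exact/val_inj.
exact: Ajw.
Qed.

Lemma measurable_future (j : nat) (A : 'I_m -> set R) :
  (forall i, measurable (A i)) -> measurable (future j A).
Proof.
move=> mA; apply: fin_bigcap_measurable => // i _.
exact: measurable_preimage.
Qed.

Lemma future_indep (j : nat) (jm : (j < m)%N) (B : set R) (A : 'I_m -> set R) :
  measurable B -> (forall i, measurable (A i)) ->
  P (X j @^-1` B `&` future j.+1 A) = P (X j @^-1` B) * P (future j.+1 A).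
Proof.
move=> mB mA; pose A' i := if i == Ordinal jm then B else A i.
have -> : future j.+1 A = future j.+1 A'.
  apply: eq_bigcapr => i; rewrite /= inE => ji; rewrite /A'; case: eqP => // iE.
  by rewrite iE /= ltnn in ji.
have -> : X j @^-1` B = X j @^-1` A' (Ordinal jm) by rewrite /A' eqxx.
have mA' i : measurable (A' i) by rewrite /A'; case: ifP.
rewrite -futureS /future !X_indep//.
rewrite (bigD1 (Ordinal jm)) ?inE//=; congr (_ * _).
apply: eq_bigl => i; rewrite !inE /= ltn_neqAle andbC; congr (_ && _).
by rewrite eq_sym.
Qed.

Variables (phi : R * R -> R) (Z : nat -> {mfun Omega >-> R}).
Hypothesis mphi : measurable_fun setT phi.
Hypothesis Z0 : forall w, Z 0%N w = 0%R.
Hypothesis ZS : forall j w, (j < m)%N -> Z j.+1 w = phi (Z j w, X j w).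

(** By induction on [j]: [Z j.+1] is a function of the pair [(Z j, X j)], which
    is independent of the increments of rank greater than [j]. *)
Lemma past_future_indep (j : nat) (B : set R) (A : 'I_m -> set R) : (j <= m)%N ->
  measurable B -> (forall i, measurable (A i)) ->
  P (Z j @^-1` B `&` future j A) = P (Z j @^-1` B) * P (future j A).
Proof.
elim: j B A => [|j IH] B A jm mB mA.
  have [B0|B0] := pselect (B 0%R).
    have -> : Z 0%N @^-1` B = setT by apply/seteqP; split=> // w _; rewrite /= Z0.
    by rewrite setTI probability_setT mul1e.
  have -> : Z 0%N @^-1` B = set0 by apply/seteqP; split=> // w; rewrite /= Z0.
  by rewrite set0I measure0 mul0e.
have triple (A' : 'I_m -> set R) (mA' : forall i, measurable (A' i)) C D :
    measurable C -> measurable D ->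
    P (Z j @^-1` C `&` X j @^-1` D `&` future j.+1 A') =
    P (Z j @^-1` C) * P (X j @^-1` D) * P (future j.+1 A').
  move=> mC mD; pose A'' i := if i == Ordinal jm then D else A' i.
  have mA'' i : measurable (A'' i) by rewrite /A''; case: ifP.
  have fE : future j.+1 A' = future j.+1 A''.
    apply: eq_bigcapr => i; rewrite /= inE => ji; rewrite /A''; case: eqP => // iE.
    by rewrite iE /= ltnn in ji.
  have DE : X j @^-1` D = X j @^-1` A'' (Ordinal jm) by rewrite /A'' eqxx.
  rewrite -setIA fE DE -futureS IH ?(ltnW jm)// (futureS jm) future_indep//.
    by rewrite muleA.
have E : Z j.+1 @^-1` B = (fun w => (Z j w, X j w)) @^-1` (phi @^-1` B).
  by apply/seteqP; split => w /=; rewrite ZS.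
have mE : measurable (phi @^-1` B) by rewrite -[X in measurable X]setTI; exact: mphi.
have futT : future j.+1 (fun=> setT) = setT.
  by apply/seteqP; split => // w _ i _.
have := joint_law_product (measurable_future j.+1 (fun=> measurableT))
  (triple _ (fun=> measurableT)) mE.
rewrite futT setIT probability_setT mule1 E => ->.
by rewrite (joint_law_product (measurable_future j.+1 mA) (triple _ mA) mE).
Qed.

Lemma past_noise_indep (j : nat) (C D : set R) : (j < m)%N ->
  measurable C -> measurable D ->
  P (Z j @^-1` C `&` X j @^-1` D) = P (Z j @^-1` C) * P (X j @^-1` D).
Proof.
move=> jm mC mD; pose A i := if i == Ordinal jm then D else setT.
have mA i : measurable (A i) by rewrite /A; case: ifP.
have -> : X j @^-1` D = future j A.
  rewrite (futureS jm) /A eqxx (_ : future _ _ = setT) ?setIT//.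
  apply/seteqP; split => // w _ i /=; rewrite inE => ji; rewrite ifF//.
  by apply/negbTE/eqP => iE; rewrite iE /= ltnn in ji.
by rewrite past_future_indep// ltnW.
Qed.

End past_and_future.
End independence.

(** * Gaussian laws *)

Section gaussian.
Local Open Scope ereal_scope.
Context {R : realType}.
Local Notation mu := (@lebesgue_measure R).

Lemma normal_prob0N (s : R) (A : set R) : s != 0%R -> measurable A ->
  normal_prob 0 s (-%R @^-1` A) = normal_prob 0 s A.
Proof.
move=> s0 mA; rewrite /normal_prob.
have mf : measurable_fun A (EFin \o normal_pdf 0 s).
  by apply/measurable_EFinP/measurable_funTS; exact: measurable_normal_pdf.
transitivity (\int[mu]_(x in (-%R : _ -> measurableTypeR R) @^-1` A)
  ((EFin \o normal_pdf 0 s) \o -%R) x).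
  apply: eq_integral => x _ /=; congr EFin.
  by rewrite !normal_pdfE// /normal_fun !subr0 sqrrN.
rewrite -ge0_integral_pushforward//=.
  apply: (@eq_measure_integral _ (measurableTypeR R) R A mu) => //= B mB _.
  exact: lebesgue_measureN.
by move=> x _; rewrite lee_fin normal_pdf_ge0.
Qed.

(** [normal_prob] is defined by its density; this is the corresponding change of
    variables for integrals, through the uniqueness of Radon-Nikodym
    derivatives. *)
Lemma ge0_integral_normal_pdf (s : R) (f : R -> \bar R) :
  measurable_fun setT f -> (forall x, 0 <= f x) ->
  \int[normal_prob 0 s]_x f x = \int[mu]_x (f x * (normal_pdf 0 s x)%:E).
Proof.
move=> mf f0.
have dom := @normal_prob_dominates R 0 s.
rewrite -(Radon_Nikodym_SigmaFinite.change_of_variables dom)//.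
have intRN := Radon_Nikodym_SigmaFinite.f_integrable dom.
apply: ae_eq_integral => //.
- by apply: emeasurable_funM => //; exact: measurable_int intRN.
- apply: emeasurable_funM => //; apply/measurable_EFinP.
  exact: measurable_normal_pdf.
- apply: ae_eqe_mul2l; apply: integral_ae_eq => //.
    by apply/measurable_EFinP; exact: measurable_normal_pdf.
  move=> E _ mE.
  by rewrite -Radon_Nikodym_SigmaFinite.f_integral.
Qed.

(** The constant is not sharp. From [u <= expR u] at [u = x ^+ 2 / (4 * s ^+ 2)],
    the integrand is dominated by a multiple of the Gaussian density of standard
    deviation [s * Num.sqrt 2], whose integral is one. *)
Lemma normal_second_moment (s : R) : (0 < s)%R ->
  \int[normal_prob 0 s]_x (x ^+ 2)%:E <= (8 * s ^+ 2)%:E.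
Proof.
move=> s0.
have mX : measurable_fun [set: R] (fun x : R => (x ^+ 2)%:E).
  by apply/measurable_EFinP; exact: measurable_funX.
rewrite ge0_integral_normal_pdf//; last by move=> x; rewrite lee_fin sqr_ge0.
pose q := Num.sqrt (2 : R).
have q0 : (0 < q)%R by rewrite sqrtr_gt0.
have q2 : (q ^+ 2 = 2)%R by rewrite sqr_sqrtr.
have s'0 : (s * q)%R != 0%R by rewrite mulf_neq0// gt_eqF.
apply: (@le_trans _ _ (\int[mu]_x ((4 * s ^+ 2 * q)%:E * (normal_pdf 0 (s * q) x)%:E))).
  apply: ge0_le_integral => //=.
  - by move=> x _; rewrite mule_ge0// lee_fin ?sqr_ge0 ?normal_pdf_ge0.
  - apply: emeasurable_funM => //; apply/measurable_EFinP.
    exact: measurable_normal_pdf.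
  - apply: emeasurable_funM => //; apply/measurable_EFinP.
    exact: measurable_normal_pdf.
  move=> x _; rewrite -!EFinM lee_fin !normal_pdfE ?gt_eqF ?mulr_gt0//.
  rewrite /normal_peak /normal_fun !subr0 exprMn q2.
  have -> : Num.sqrt (s ^+ 2 * 2 * pi *+ 2) = (q * Num.sqrt (s ^+ 2 * pi *+ 2))%R.
    by rewrite /q -sqrtrM//; congr Num.sqrt; rewrite !mulr2n; ring.
  rewrite invfM.
  have -> : (4 * s ^+ 2 * q * (q^-1 * (Num.sqrt (s ^+ 2 * pi *+ 2))^-1 *
        expR (- x ^+ 2 / (s ^+ 2 * 2 *+ 2))) =
      (Num.sqrt (s ^+ 2 * pi *+ 2))^-1 *
        (4 * s ^+ 2 * expR (- x ^+ 2 / (s ^+ 2 * 2 *+ 2))))%R.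
    by field; rewrite !gt_eqF// sqrtr_gt0 pmulrn_lgt0// mulr_gt0 ?pi_gt0// exprn_gt0.
  rewrite [leLHS]mulrCA ler_wpM2l ?invr_ge0 ?sqrtr_ge0//.
  have -> : (- x ^+ 2 / (s ^+ 2 *+ 2) =
      - x ^+ 2 / (s ^+ 2 * 2 *+ 2) - x ^+ 2 / (4 * s ^+ 2))%R.
    by field; rewrite gt_eqF.
  rewrite expRD mulrA [leLHS]mulrAC ler_wpM2r ?expR_ge0//.
  rewrite expRN ler_pdivrMr ?expR_gt0//.
  set u := (x ^+ 2 / _)%R.
  have -> : (x ^+ 2 = 4 * s ^+ 2 * u)%R by rewrite /u; field; rewrite gt_eqF.
  rewrite ler_wpM2l//; first by rewrite mulr_ge0// exprn_ge0// ltW.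
  by apply: le_trans (expR_ge1Dx u); rewrite lerDr.
rewrite ge0_integralZl//; last 3 first.
- by apply/measurable_EFinP; exact: measurable_normal_pdf.
- by move=> x _; rewrite lee_fin normal_pdf_ge0.
- by rewrite lee_fin !mulr_ge0 ?exprn_ge0 ?(ltW q0) ?(ltW s0).
rewrite integral_normal_pdf mule1 lee_fin.
suff : (q <= 2)%R by have := sqr_ge0 s; nra.
by nra.
Qed.

(** A lower bound for the mass given to [`[s / 2, s]] by the centred Gaussian law
    of standard deviation [s]: the length [s / 2] times the density at [s], its
    minimum there. What matters is that the product does not depend on [s]. *)
Definition shell_mass : R := (expR (- 2^-1) / (2 * Num.sqrt (pi *+ 2)))%R.

Lemma shell_mass_gt0 : (0 < shell_mass)%R.
Proof. by rewrite divr_gt0 ?expR_gt0// mulr_gt0// sqrtr_gt0 pmulrn_lgt0// pi_gt0. Qed.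

Lemma normal_shell (s : R) : (0 < s)%R ->
  shell_mass%:E <= normal_prob 0 s `[(s / 2)%R, s].
Proof.
move=> s0; rewrite /normal_prob.
apply: (@le_trans _ _ (\int[mu]_(x in `[(s / 2)%R, s])
    (cst (normal_peak s * expR (- 2^-1))%:E x))).
  rewrite integral_cst//= lebesgue_measure_itv/= lte_fin ifT; last by lra.
  rewrite -EFinB -EFinM lee_fin /normal_peak /shell_mass.
  have -> : Num.sqrt (s ^+ 2 * pi *+ 2) = (s * Num.sqrt (pi *+ 2))%R.
    by rewrite -mulrnAr sqrtrM ?sqr_ge0// sqrtr_sqr gtr0_norm.
  rewrite le_eqVlt; apply/orP; left; apply/eqP.
  by field; rewrite !gt_eqF// sqrtr_gt0 pmulrn_lgt0// pi_gt0.
apply: ge0_le_integral => //=.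
- by move=> x _; rewrite lee_fin mulr_ge0 ?expR_ge0 ?normal_peak_ge0.
- by apply/measurable_EFinP/measurable_funTS; exact: measurable_normal_pdf.
move=> x; rewrite /= in_itv/= => /andP[sx xs].
rewrite lee_fin normal_pdfE ?gt_eqF// ler_wpM2l ?normal_peak_ge0//.
rewrite /normal_fun ler_expR subr0 mulNr lerN2 ler_pdivrMr; last first.
  by rewrite pmulrn_lgt0// exprn_gt0.
by rewrite -mulr_natr; nra.
Qed.

(** The laws of increments are measures on the Borel sets of [R], whereas
    [normal_prob] lives on the same sets presented as a generated sigma-algebra.
    This section transports integrals from one presentation to the other. *)
Section normal_law.
Variables (s : R) (nu : {measure set R -> \bar R}).
Hypothesis s_gt0 : (0 < s)%R.
Hypothesis nuE : forall A, measurable A -> nu A = normal_prob 0 s A.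

Lemma ge0_integral_normal_law (f : R -> \bar R) :
  measurable_fun setT f -> (forall x, 0 <= f x) ->
  \int[nu]_x f x = \int[normal_prob 0 s]_x f x.
Proof.
move=> mf f0; pose i : measurableTypeR R -> R := id.
have mi : measurable_fun setT i by move=> _ A mA; rewrite setTI.
pose law : measure R R := pushforward (normal_prob 0 s) i.
transitivity (\int[law mi]_x f x).
  by apply: eq_measure_integral => A mA _; exact: nuE.
by rewrite ge0_integral_pushforward.
Qed.

Lemma ge0_integral_normal_lawN (f : R -> \bar R) :
  measurable_fun setT f -> (forall x, 0 <= f x) ->
  \int[nu]_x f (- x)%R = \int[nu]_x f x.
Proof.
move=> mf f0.
have mN : measurable_fun setT (-%R : R -> R) by exact: oppr_measurable.
pose law : measure R R := pushforward nu (-%R : R -> R).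
transitivity (\int[law mN]_x f x); first by rewrite [RHS]ge0_integral_pushforward.
apply: eq_measure_integral => A mA _; rewrite /law /= /pushforward !nuE//.
  by rewrite normal_prob0N ?gt_eqF.
by rewrite -[X in measurable X]setTI; exact: mN.
Qed.

End normal_law.
End gaussian.

(** * Mean growth of the potential under Gaussian noise *)

Section gaussian_gain.
Local Open Scope ereal_scope.
Context {R : realType}.
Variable b : R -> R.
Hypothesis bP : admissible_drift b.
Let b'_cont := derive1_drift_continuous bP.
Let b'_ge0 := derive1_drift_ge0 bP.
Let b'_anti := derive1_drift_antitone bP.
Let F_ge0 := potential_ge0 bP.
Let F_cont := potential_continuous bP.
Let F_tangent := potential_tangent bP.
Let F_gain := potential_gain bP.

Lemma measurable_potential_shift (z : R) :
  measurable_fun setT (fun x : R => (potential b (z + x))%:E).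
Proof.
apply/measurable_EFinP; apply: continuous_measurable_fun => x.
apply: (@continuous_comp R R R (fun x => z + x)%R); last exact: F_cont.
by apply: cvgD; [exact: cvg_cst|exact: cvg_id].
Qed.

(** The first-order terms of [potential_gain] at [x] and [- x] cancel; outside
    the shell [`[s / 2, s]] convexity alone is used. *)
Lemma potential_symmetric_gain (s e z x : R) : (0 < s)%R -> (s <= e)%R ->
  (2 * potential b z + s ^+ 2 / 8 * derive1 b (`|z| + e) * \1_`[s / 2, s]%classic x <=
   potential b (z + x) + potential b (z - x))%R.
Proof.
move=> s0 se.
have g0 : (0 <= derive1 b (`|z| + e))%R.
  by apply: b'_ge0; rewrite ltr_wpDl// (lt_le_trans s0).
rewrite indicE; case: (boolP (x \in _)) => [|_]; last first.
  by have := F_tangent z (z + x); have := F_tangent z (z - x); rewrite mulr0; lra.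
rewrite inE /= in_itv/= => /andP[sx xs]; rewrite mulr1.
have xpos : (0 <= x)%R by lra.
have xsn : (`|x| <= s)%R by rewrite ger0_norm.
have xsn' : (`|- x| <= s)%R by rewrite normrN.
have g1 : (derive1 b (`|z| + e) <= derive1 b (`|z| + s))%R.
  by apply: b'_anti; [rewrite ltr_wpDl|rewrite lerD2l].
have x2 : (s ^+ 2 / 4 <= x ^+ 2)%R by nra.
have h1 := F_gain z s0 xsn; have h2 := F_gain z s0 xsn'.
rewrite sqrrN in h2.
have : (derive1 b (`|z| + e) * (s ^+ 2 / 4) <= derive1 b (`|z| + s) * x ^+ 2)%R.
  by rewrite ler_pM// divr_ge0// sqr_ge0.
by nra.
Qed.

Lemma normal_law_gain (s e z : R) (nu : {measure set R -> \bar R}) :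
  (0 < s)%R -> (s <= e)%R ->
  (forall A, measurable A -> nu A = normal_prob 0 s A) ->
  (potential b z + shell_mass / 16 * s ^+ 2 * derive1 b (`|z| + e))%:E <=
  \int[nu]_x (potential b (z + x))%:E.
Proof.
move=> s0 se nuE.
have g0 : (0 <= derive1 b (`|z| + e))%R.
  by apply: b'_ge0; rewrite ltr_wpDl// (lt_le_trans s0).
set k := (s ^+ 2 / 8 * derive1 b (`|z| + e))%R.
have k0 : (0 <= k)%R by rewrite mulr_ge0// divr_ge0// sqr_ge0.
rewrite -(@lee_pmul2l _ 2%:E)// [X in _ <= X]mule_natl mule2n.
rewrite -{2}(ge0_integral_normal_lawN s0 nuE (measurable_potential_shift z));
  last by move=> x; rewrite lee_fin.
have mN : measurable_fun setT (fun x : R => (potential b (z - x))%:E).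
  exact: measurableT_comp (measurable_potential_shift z) (@oppr_measurable R setT).
rewrite -ge0_integralD//; last 3 first.
- by move=> x _; rewrite lee_fin.
- exact: measurable_potential_shift.
- by move=> x _; rewrite lee_fin.
apply: (@le_trans _ _ (\int[nu]_x
    ((2 * potential b z)%:E + k%:E * (\1_`[s / 2, s]%classic x)%:E))); last first.
  apply: ge0_le_integral => //=.
  - by move=> x _; rewrite -EFinM -EFinD lee_fin addr_ge0// mulr_ge0.
  - apply: emeasurable_funD => //; apply: emeasurable_funM => //.
    by apply/measurable_EFinP; exact: measurable_indic.
  - by apply: emeasurable_funD => //; exact: measurable_potential_shift.
  by move=> x _; rewrite -EFinM -!EFinD lee_fin potential_symmetric_gain.
rewrite ge0_integralD//; last 3 first.
- by move=> x _; rewrite lee_fin mulr_ge0.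
- by move=> x _; rewrite -EFinM lee_fin mulr_ge0.
- by apply: emeasurable_funM => //; apply/measurable_EFinP; exact: measurable_indic.
rewrite integral_cst// ge0_integralZl//; last first.
  by apply/measurable_EFinP; exact: measurable_indic.
rewrite integral_indic// setIT !nuE// probability_setT mule1.
rewrite -EFinM mulrDr EFinD leeD2l//.
apply: (@le_trans _ _ (k%:E * shell_mass%:E)); last first.
  by rewrite lee_wpmul2l ?lee_fin// normal_shell.
by rewrite -EFinM lee_fin /k le_eqVlt; apply/orP; left; apply/eqP; field.
Qed.

Lemma independent_gaussian_gain (d : measure_display) (Omega : measurableType d)
    (P : probability Omega R) (s e : R) (Z X : {mfun Omega >-> R}) :
  (0 < s)%R -> (s <= e)%R ->
  (forall A, measurable A -> distribution P X A = normal_prob 0 s A) ->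
  (forall A B, measurable A -> measurable B ->
    P (Z @^-1` A `&` X @^-1` B) = P (Z @^-1` A) * P (X @^-1` B)) ->
  \int[P]_w (potential b (Z w) + shell_mass / 16 * s ^+ 2 * derive1 b (`|Z w| + e))%:E <=
  \int[P]_w (potential b (Z w + X w))%:E.
Proof.
move=> s0 se Xlaw ZX.
have e0 : (0 < e)%R by exact: lt_le_trans se.
pose g z := (potential b z + shell_mass / 16 * s ^+ 2 * derive1 b (`|z| + e))%:E.
pose f (p : R * R) := (potential b (p.1 + p.2))%:E.
have mg : measurable_fun setT g.
  apply/measurable_EFinP; apply: continuous_measurable_fun => z.
  apply: cvgD; first exact: F_cont.
  apply: cvgM; first exact: cvg_cst.
  apply: (@continuous_comp R R R (fun x => `|x| + e)%R).
    by apply: cvgD; [exact: norm_continuous|exact: cvg_cst].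
  by apply: b'_cont; rewrite in_itv/= andbT ltr_wpDl.
have g0 z : 0 <= g z.
  rewrite lee_fin addr_ge0// mulr_ge0//.
    by rewrite mulr_ge0 ?sqr_ge0// divr_ge0// ltW// shell_mass_gt0.
  by rewrite b'_ge0// ltr_wpDl.
have mf : measurable_fun setT f.
  apply/measurable_EFinP/measurableT_comp; first exact: continuous_measurable_fun.
  by apply: measurable_funD; [exact: measurable_fst|exact: measurable_snd].
have f0 p : 0 <= f p by rewrite lee_fin.
rewrite -[leRHS]/(\int[P]_w f (Z w, X w)) (ge0_integral_joint_law ZX mf f0).
rewrite -[leLHS]/(\int[P]_w (g \o Z) w) -ge0_integral_distribution//.
apply: ge0_le_integral => //.
- exact: (@measurable_fun_fubini_tonelli_F _ _ _ _ _ (distribution P X) f).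
- by move=> z _; exact: normal_law_gain.
Qed.

End gaussian_gain.

(** * Expected exponents of the Euler schemes *)

Section brownian_exponent.
Local Open Scope ereal_scope.
Context {R : realType} {d : measure_display} {Omega : measurableType d}.
Variables (P : probability Omega R) (T : R) (W : R -> {RV P >-> R}).
Hypothesis T_gt0 : (0 < T)%R.
Hypothesis W_bm : is_brownian_motion T W.
Variable b : R -> R.
Hypothesis bP : admissible_drift b.
Variable C : R.
Hypothesis b_growth : forall x : R, (`|b x| <= C * (1 + `|x|))%R.

Let b_ge0 := drift_ge0 bP.
Let b'_ge0 := derive1_drift_ge0 bP.
Let F_ge0 := potential_ge0 bP.
Let F_cont := potential_continuous bP.

Let C_ge0 : (0 <= C)%R.
Proof. by have := b_growth 0; rewrite normr0 addr0 mulr1; apply: le_trans. Qed.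

Lemma integral_cst_probability (r : R) : \int[P]_w r%:E = r%:E.
Proof.
transitivity (r%:E * P setT); first exact: integral_cst.
by rewrite probability_setT mule1.
Qed.

Lemma brownian_second_moment (t : R) : (0 < t)%R -> (t <= T)%R ->
  \int[P]_w ((increment W 0 t w) ^+ 2)%:E <= (8 * T)%:E.
Proof.
move=> t0 tT.
have s0 : (0 < Num.sqrt t)%R by rewrite sqrtr_gt0.
have law A : measurable A ->
    distribution P (increment W 0 t) A = normal_prob 0 (Num.sqrt t) A.
  by move=> mA; rewrite (bm_gaussian W_bm (lexx 0%R) t0 tT mA) subr0.
have mX : measurable_fun setT (fun x : R => (x ^+ 2)%:E).
  by apply/measurable_EFinP; exact: measurable_funX.
have X0 x : 0 <= (x ^+ 2)%:E :> \bar R by rewrite lee_fin sqr_ge0.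
rewrite -[leLHS]/(\int[P]_w ((fun x : R => (x ^+ 2)%:E) \o increment W 0 t) w).
rewrite -ge0_integral_distribution// (ge0_integral_normal_law law)//.
apply: le_trans (normal_second_moment s0) _.
by rewrite lee_fin sqr_sqrtr ?(ltW t0)// ler_wpM2l.
Qed.

Section one_scheme.
Variables (N e : R) (m : nat).
Hypothesis N_ge0 : (0 <= N)%R.
Hypothesis e_gt0 : (0 < e)%R.
Hypothesis m_gt0 : (0 < m)%N.
Local Notation h := (step T m).
Hypothesis h_le : (h <= e ^+ 2)%R.
Local Notation beta := (reg_drift b N e).
Local Notation B := (b (- N)).

Let X (i : nat) : {mfun Omega >-> R} := increment W (h * i%:R) (h * i.+1%:R).
Let Z (j : nat) (w : Omega) : R := euler beta h (noise T (fun t => W t w) m) j.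

Let h_gt0 : (0 < h)%R.
Proof. by rewrite divr_gt0// ltr0n. Qed.

Let ZS j w : Z j.+1 w = (Z j w + h * beta (Z j w) + X j w)%R.
Proof. by []. Qed.

Let grid_leT j : (j <= m)%N -> (h * j%:R <= T)%R.
Proof.
move=> jm; rewrite /step mulrAC ler_pdivrMr ?ltr0n// ler_wpM2l ?(ltW T_gt0)//.
by rewrite ler_nat.
Qed.

Let m_beta : measurable_fun setT beta.
Proof. by apply: continuous_measurable_fun; exact: reg_drift_continuous. Qed.

Let m_Z j : measurable_fun setT (Z j).
Proof.
elim: j => [|j IH]; first exact: measurable_cst.
apply: (eq_measurable_fun (fun w => Z j w + h * beta (Z j w) + X j w)%R) => //.
apply: measurable_funD; last exact: measurable_funPT.
apply: measurable_funD => //; apply: measurable_funM => //.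
exact: measurableT_comp.
Qed.

Let X_law j : (j < m)%N -> forall A, measurable A ->
  distribution P (X j) A = normal_prob 0 (Num.sqrt h) A.
Proof.
move=> jm A mA.
have j0 : (0 <= h * j%:R)%R by rewrite mulr_ge0 ?ler0n// ltW.
have jj : (h * j%:R < h * j.+1%:R)%R by rewrite ltr_pM2l// ltr_nat.
rewrite (bm_gaussian W_bm j0 jj (grid_leT jm) mA).
by congr (normal_prob 0 (Num.sqrt _) A); rewrite -natr1 mulrDr mulr1 addrAC subrr add0r.
Qed.

Let X_indep : @independent_RVs d Omega R P _ (fun i : 'I_m => X i).
Proof.
apply: (bm_independent W_bm (t := fun i => (h * i%:R)%R)).
- by rewrite mulr0.
- by move=> i _; rewrite ler_pM2l// ler_nat.
- exact: grid_leT.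
Qed.

Let ZX_indep j : (j < m)%N -> forall A A', measurable A -> measurable A' ->
  P (Z j @^-1` A `&` X j @^-1` A') = P (Z j @^-1` A) * P (X j @^-1` A').
Proof.
move=> jm A A' mA mA'.
have /choice[Z' Z'E] := fun j => mfun_of_measurable (m_Z j).
rewrite -Z'E.
apply: (past_noise_indep X_indep (phi := fun p => (p.1 + h * beta p.1 + p.2)%R)) => //.
- apply: measurable_funD; last exact: measurable_snd.
  apply: measurable_funD; first exact: measurable_fst.
  by apply: measurable_funM => //; apply: measurableT_comp => //; exact: measurable_fst.
- by move=> w; rewrite Z'E.
- by move=> i w _; rewrite !Z'E ZS.
Qed.

Let Z_near j w : (`|Z j w - increment W 0 (h * j%:R) w| <= B * (h * j%:R))%R.
Proof.
elim: j => [|j IH].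
  by rewrite /= /increment /= !mulr0 subrr subrr normr0.
have h1 := reg_drift_ge0 bP N (Z j w) (ltW e_gt0).
have h2 := reg_drift_le_max bP (Z j w) N_ge0 (ltW e_gt0).
have h3 : (0 <= h * beta (Z j w))%R by rewrite mulr_ge0// ltW.
have h4 : (h * beta (Z j w) <= B * h)%R by rewrite [leRHS]mulrC ler_wpM2l// ltW.
have E : (B * (h * j.+1%:R) = B * (h * j%:R) + B * h)%R by rewrite -natr1; ring.
rewrite ZS /X E.
move: IH; rewrite /increment /= !ler_norml => /andP[l u].
by apply/andP; split; lra.
Qed.

Let moment_bound : R := (1 + 8 * T)%R.

Let cost : R := (B * (C * (1 + B * T + moment_bound)))%R.

Let integral_norm_le j : (0 < j)%N -> (j <= m)%N ->
  \int[P]_w `|increment W 0 (h * j%:R) w|%:E <= moment_bound%:E.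
Proof.
move=> j0 jm.
have mI := measurable_funPT (increment W 0 (h * j%:R)).
apply: (@le_trans _ _ (\int[P]_w (1 + ((increment W 0 (h * j%:R) w) ^+ 2)%:E))).
  apply: ge0_le_integral => //=.
  - by apply/measurable_EFinP; exact: measurableT_comp.
  - apply: emeasurable_funD => //; apply/measurable_EFinP.
    exact: measurable_funX.
  move=> w _; rewrite -EFinD lee_fin; set x := (X in (`|X| <= _)%R).
  have : (0 <= (`|x| - 1) ^+ 2)%R by exact: sqr_ge0.
  by rewrite -(real_normK (num_real x)) ; have := normr_ge0 x; nra.
rewrite ge0_integralD//; last 2 first.
- by move=> w _; rewrite lee_fin sqr_ge0.
- by apply/measurable_EFinP; exact: measurable_funX.
rewrite integral_cst_probability EFinD leeD2l//.
apply: brownian_second_moment; last exact: grid_leT.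
by rewrite mulr_gt0 ?ltr0n.
Qed.


Let m_F : measurable_fun setT (potential b).
Proof. exact: continuous_measurable_fun. Qed.

Let m_G : measurable_fun setT (fun x : R => derive1 b (`|x| + e)%R).
Proof.
apply: continuous_measurable_fun => z.
apply: (@continuous_comp R R R (fun x => `|x| + e)%R).
  by apply: cvgD; [exact: norm_continuous|exact: cvg_cst].
by apply: (derive1_drift_continuous bP); rewrite in_itv/= andbT ltr_wpDl.
Qed.

Let G_ge0 (x : R) : (0 <= derive1 b (`|x| + e))%R.
Proof. by rewrite b'_ge0// ltr_wpDl. Qed.

Let c : R := (shell_mass / 16)%R.

Let c_gt0 : (0 < c)%R.
Proof. by rewrite divr_gt0// shell_mass_gt0. Qed.

Let partial_exponent (j : nat) (w : Omega) : R :=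
  (h * \sum_(i < j) derive1 b (`|Z i w| + e))%R.

Let partial_exponentS j w :
  partial_exponent j.+1 w = (partial_exponent j w + h * derive1 b (`|Z j w| + e))%R.
Proof. by rewrite /partial_exponent big_ord_recr/= mulrDr. Qed.

Let partial_exponent_ge0 j w : (0 <= partial_exponent j w)%R.
Proof. by rewrite mulr_ge0 ?sumr_ge0// ltW. Qed.

Let m_partial_exponent j : measurable_fun setT (partial_exponent j).
Proof.
elim: j => [|j IH].
  suff -> : partial_exponent 0 = cst 0%R by exact: measurable_cst.
  by apply/funext => w; rewrite /partial_exponent big_ord0 mulr0.
apply: (eq_measurable_fun (fun w => partial_exponent j w + h * derive1 b (`|Z j w| + e))%R).
  by move=> w _; rewrite partial_exponentS.
apply: measurable_funD => //; apply: measurable_funM => //.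
exact: (measurableT_comp m_G).
Qed.

Let B_ge0 : (0 <= B)%R.
Proof. exact: b_ge0. Qed.

Let moment_ge0 : (0 <= moment_bound)%R.
Proof. by rewrite addr_ge0// mulr_ge0// ltW. Qed.

Let cost_ge0 : (0 <= cost)%R.
Proof. by rewrite !mulr_ge0// !addr_ge0// mulr_ge0// ltW. Qed.

(** One step of the scheme is split into the addition of the noise, during which
    the mean potential gains the term to be controlled, and the addition of the
    drift, which costs at most [h * cost]. *)
Let gain_step j : (j < m)%N ->
  \int[P]_w (potential b (Z j w))%:E +
    (c * h)%:E * \int[P]_w (derive1 b (`|Z j w| + e))%:E <=
  \int[P]_w (potential b (Z j w + X j w))%:E.
Proof.
move=> jm.
have s0 : (0 < Num.sqrt h)%R by rewrite sqrtr_gt0.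
have se : (Num.sqrt h <= e)%R.
  by rewrite -(ger0_norm (ltW e_gt0)) -sqrtr_sqr ler_wsqrtr.
have [Z' Z'E] := mfun_of_measurable (m_Z j).
have := @independent_gaussian_gain _ _ bP _ _ P _ _ Z' (X j) s0 se (X_law jm).
rewrite Z'E => /(_ (ZX_indep jm)); apply: le_trans.
rewrite sqr_sqrtr ?(ltW h_gt0)//.
rewrite -ge0_integralZl//; last 3 first.
- by apply/measurable_EFinP; exact: (measurableT_comp m_G).
- by move=> w _; rewrite lee_fin.
- by rewrite lee_fin mulr_ge0 ?ltW.
rewrite -ge0_integralD//; last 4 first.
- by move=> w _; rewrite lee_fin.
- by apply/measurable_EFinP; exact: measurableT_comp.
- by move=> w _; rewrite -EFinM lee_fin mulr_ge0// mulr_ge0 ?ltW.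
- apply: emeasurable_funM => //; apply/measurable_EFinP.
  exact: (measurableT_comp m_G).
Qed.

Let drift_step j : (j < m)%N ->
  \int[P]_w (potential b (Z j w + X j w))%:E <=
  \int[P]_w (potential b (Z j.+1 w))%:E + (h * cost)%:E.
Proof.
move=> jm.
have mI := measurable_funPT (increment W 0 (h * j.+1%:R)).
have mI' : measurable_fun setT (fun w => `|increment W 0 (h * j.+1%:R) w|%:E).
  by apply/measurable_EFinP; exact: measurableT_comp.
pose k1 := (h * B * C)%R; pose k2 := (h * B * (C * (1 + B * T)))%R.
have k10 : (0 <= k1)%R by rewrite !mulr_ge0// ltW.
have k20 : (0 <= k2)%R by rewrite !mulr_ge0 ?addr_ge0 ?mulr_ge0// ltW.
apply: (@le_trans _ _ (\int[P]_w ((potential b (Z j.+1 w))%:E +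
   (k2%:E + k1%:E * `|increment W 0 (h * j.+1%:R) w|%:E)))).
  apply: ge0_le_integral => //=.
  - by move=> w _; rewrite lee_fin.
  - apply/measurable_EFinP; apply: (measurableT_comp m_F).
    exact: (measurable_funD (m_Z j) (measurable_funPT (X j))).
  - apply: emeasurable_funD.
      by apply/measurable_EFinP; exact: (measurableT_comp m_F (m_Z j.+1)).
    by apply: emeasurable_funD => //; exact: emeasurable_funM.
  move=> w _; rewrite -EFinM -!EFinD lee_fin.
  set V := (Z j w + X j w)%R.
  have ZV : Z j.+1 w = (V + h * beta (Z j w))%R by rewrite ZS /V; ring.
  have t1 := potential_tangent bP V (Z j.+1 w).
  have beta0 := reg_drift_ge0 bP N (Z j w) (ltW e_gt0).
  have betaB := reg_drift_le_max bP (Z j w) N_ge0 (ltW e_gt0).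
  have sl : (`|slope b V| <= C * (1 + `|V|))%R.
    rewrite norm_slope//; apply: le_trans (ler_norm _) _.
    by apply: le_trans (b_growth _) _; rewrite normr_id.
  have V1 : (`|V| <= B * T + `|increment W 0 (h * j.+1%:R) w|)%R.
    have -> : V = (Z j w - increment W 0 (h * j%:R) w + increment W 0 (h * j.+1%:R) w)%R.
      by rewrite /V /X /increment /=; ring.
    apply: le_trans (ler_normD _ _) _; rewrite lerD2r.
    apply: le_trans (Z_near j w) _; rewrite ler_wpM2l//.
    exact/grid_leT/ltnW.
  have t2 : (`|slope b V * (Z j.+1 w - V)| <=
      k2 + k1 * `|increment W 0 (h * j.+1%:R) w|)%R.
    have -> : (Z j.+1 w - V = h * beta (Z j w))%R by rewrite ZV; ring.
    rewrite normrM.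
    apply: (@le_trans _ _
      (C * (1 + (B * T + `|increment W 0 (h * j.+1%:R) w|)) * (h * B)))%R.
      apply: ler_pM => //.
        by apply: le_trans sl _; rewrite ler_wpM2l// lerD2l.
      by rewrite normrM (ger0_norm beta0) gtr0_norm// ler_wpM2l// ltW.
    by rewrite /k1 /k2 le_eqVlt; apply/orP; left; apply/eqP; ring.
  have := ler_norm (- (slope b V * (Z j.+1 w - V)))%R.
  by rewrite normrN; lra.
rewrite ge0_integralD//; last 4 first.
- by move=> w _; rewrite lee_fin.
- by apply/measurable_EFinP; exact: (measurableT_comp m_F (m_Z j.+1)).
- by move=> w _; rewrite -EFinM -EFinD lee_fin addr_ge0// mulr_ge0.
- by apply: emeasurable_funD => //; exact: emeasurable_funM.
rewrite leeD2l// ge0_integralD//; last 2 first.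
- by move=> w _; rewrite -EFinM lee_fin mulr_ge0.
- exact: emeasurable_funM.
rewrite integral_cst_probability ge0_integralZl//.
apply: (@le_trans _ _ (k2%:E + k1%:E * moment_bound%:E)).
  by rewrite leeD2l// lee_wpmul2l ?lee_fin// integral_norm_le.
rewrite -EFinM -EFinD lee_fin /k1 /k2 /cost.
by rewrite le_eqVlt; apply/orP; left; apply/eqP; ring.
Qed.

Let exponent_telescope j : (j <= m)%N ->
  c%:E * \int[P]_w (partial_exponent j w)%:E <=
  \int[P]_w (potential b (Z j w))%:E + (j%:R * (h * cost))%:E.
Proof.
elim: j => [_|j IH jm].
  under eq_integral do rewrite /partial_exponent big_ord0 mulr0.
  rewrite integral0 mule0 mul0r adde0; apply: integral_ge0 => w _.
  by rewrite lee_fin.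
have -> : \int[P]_w (partial_exponent j.+1 w)%:E =
    \int[P]_w (partial_exponent j w)%:E + h%:E * \int[P]_w (derive1 b (`|Z j w| + e))%:E.
  rewrite -ge0_integralZl//; last 3 first.
  - by apply/measurable_EFinP; exact: (measurableT_comp m_G).
  - by move=> w _; rewrite lee_fin.
  - by rewrite lee_fin ltW.
  rewrite -ge0_integralD//; last 4 first.
  - by move=> w _; rewrite lee_fin.
  - exact/measurable_EFinP.
  - by move=> w _; rewrite -EFinM lee_fin mulr_ge0// ltW.
  - apply: emeasurable_funM => //; apply/measurable_EFinP.
    exact: (measurableT_comp m_G).
  by apply: eq_integral => w _; rewrite partial_exponentS EFinD EFinM.
have G0 : 0 <= \int[P]_w (derive1 b (`|Z j w| + e))%:E.
  by apply: integral_ge0 => w _; rewrite lee_fin.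
rewrite ge0_muleDr//; last 2 first.
- by apply: integral_ge0 => w _; rewrite lee_fin.
- by rewrite mule_ge0// lee_fin ltW.
apply: le_trans (leeD2r _ (IH (ltnW jm))) _.
rewrite muleA -EFinM addeAC.
apply: le_trans (leeD2r _ (gain_step jm)) _.
apply: le_trans (leeD2r _ (drift_step jm)) _.
rewrite -addeA leeD2l// -EFinD lee_fin -natr1.
by rewrite le_eqVlt; apply/orP; left; apply/eqP; ring.
Qed.

Let potential_bound : R := (C * (1 + 4 * (8 * T) + 4 * (B * T) ^+ 2))%R.

Let terminal_potential : \int[P]_w (potential b (Z m w))%:E <= potential_bound%:E.
Proof.
have hm : (h * m%:R = T)%R by rewrite /step divfK// pnatr_eq0 -lt0n.
pose Y := increment W 0 T.
have mY2 : measurable_fun setT (fun w => ((Y w) ^+ 2)%:E).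
  by apply/measurable_EFinP; apply: measurable_funX; exact: measurable_funPT.
pose k := (C * (1 + 4 * (B * T) ^+ 2))%R.
have k0 : (0 <= k)%R by rewrite mulr_ge0// addr_ge0// mulr_ge0// sqr_ge0.
apply: (@le_trans _ _ (\int[P]_w (k%:E + (4 * C)%:E * ((Y w) ^+ 2)%:E))).
  apply: ge0_le_integral => //=.
  - by move=> w _; rewrite lee_fin.
  - by apply/measurable_EFinP; exact: (measurableT_comp m_F (m_Z m)).
  - by apply: emeasurable_funD => //; exact: emeasurable_funM.
  move=> w _; rewrite -EFinM -EFinD lee_fin.
  have Zm : (`|Z m w| <= B * T + `|Y w|)%R.
    have := Z_near m w; rewrite hm => Zw.
    have -> : Z m w = (Z m w - Y w + Y w)%R by ring.
    by apply: le_trans (ler_normD _ _) _; rewrite lerD2r.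
  apply: le_trans (potential_le bP _) _.
  have bZ : (b `|Z m w| <= C * (1 + `|Z m w|))%R.
    by apply: le_trans (ler_norm _) _; apply: le_trans (b_growth _) _; rewrite normr_id.
  have Z0 := normr_ge0 (Z m w); have Y0 := normr_ge0 (Y w).
  have Y2 : (`|Y w| ^+ 2 = Y w ^+ 2)%R by rewrite real_normK// num_real.
  have BT0 : (0 <= B * T)%R by rewrite mulr_ge0// ltW.
  apply: (@le_trans _ _ (C * (1 + 2 * `|Z m w| ^+ 2)))%R.
    apply: (@le_trans _ _ (`|Z m w| * (C * (1 + `|Z m w|))))%R.
      by rewrite ler_wpM2l.
    rewrite mulrCA ler_wpM2l//.
    by have := sqr_ge0 (`|Z m w| - 1)%R; nra.
  have Z2 : (`|Z m w| ^+ 2 <= 2 * (B * T) ^+ 2 + 2 * Y w ^+ 2)%R.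
    apply: (@le_trans _ _ ((B * T + `|Y w|) ^+ 2))%R.
      by rewrite ler_sqr ?nnegrE// addr_ge0.
    by rewrite -Y2; have := sqr_ge0 (B * T - `|Y w|)%R; nra.
  have -> : (k + 4 * C * Y w ^+ 2 = C * (1 + 4 * (B * T) ^+ 2 + 4 * Y w ^+ 2))%R.
    by rewrite /k; ring.
  by rewrite ler_wpM2l//; lra.
have C40 : (0 <= 4 * C)%R by rewrite mulr_ge0.
rewrite ge0_integralD//; last 2 first.
- by move=> w _; rewrite -EFinM lee_fin mulr_ge0// sqr_ge0.
- exact: emeasurable_funM.
rewrite integral_cst_probability ge0_integralZl//; last first.
  by move=> w _; rewrite lee_fin sqr_ge0.
apply: (@le_trans _ _ (k%:E + (4 * C)%:E * (8 * T)%:E)).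
  by rewrite leeD2l// lee_wpmul2l ?lee_fin// brownian_second_moment.
rewrite -EFinM -EFinD lee_fin /k /potential_bound.
by rewrite le_eqVlt; apply/orP; left; apply/eqP; ring.
Qed.

Lemma measurable_gronwall_exponent :
  measurable_fun setT (fun w => gronwall_exponent b T (fun t => W t w) N e m).
Proof. exact: m_partial_exponent. Qed.

(** The bound depends neither on the regularisation [e] nor on the number of
    steps: the accumulated gain is at most the final mean potential plus the
    total cost of the drift. *)
Lemma expected_gronwall_exponent_le :
  \int[P]_w (gronwall_exponent b T (fun t => W t w) N e m)%:E <=
  ((potential_bound + T * cost) / c)%:E.
Proof.
have := exponent_telescope (leqnn m).
have hm : (m%:R * (h * cost) = T * cost)%R.
  by rewrite mulrA (mulrC m%:R) /step divfK// pnatr_eq0 -lt0n.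
rewrite hm => /le_trans/(_ (leeD2r _ terminal_potential)).
by rewrite -EFinD muleC -lee_pdivlMr.
Qed.

End one_scheme.

End brownian_exponent.

(** * From expectations to paths *)

Section frequently_bounded.
Local Open Scope ereal_scope.
Context {R : realType} {d : measure_display} {Omega : measurableType d}.

Lemma limn_einf_le (u : (\bar R)^nat) (K : \bar R) :
  (\forall n \near \oo, u n <= K) -> limn_einf u <= K.
Proof.
move=> [n0 _ uK]; rewrite limn_einf_lim.
apply: lime_le; first exact: is_cvg_einfs.
apply: nearW => n; apply: (@le_trans _ _ (u (maxn n n0))).
  by apply: ereal_inf_lbound; exists (maxn n n0) => //=; exact: leq_maxl.
by apply: uK => /=; exact: leq_maxr.
Qed.

Lemma limn_einf_lt_frequently (u : (\bar R)^nat) (K : \bar R) : limn_einf u < K ->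
  forall n0, exists2 n, (n0 <= n)%N & u n < K.
Proof.
rewrite limn_einf_lim => uK n0.
have /ereal_inf_lt[_ [n /= n0n <-] unK] : einfs u n0 < K.
  apply: le_lt_trans uK; rewrite (cvg_lim _ (@cvg_einfs_sup _ u))//.
  by apply: ereal_sup_ubound; exists n0.
by exists n.
Qed.

Lemma measurable_fun_limn_einf (f : (Omega -> \bar R)^nat) :
  (forall n, measurable_fun setT (f n)) ->
  measurable_fun setT (fun w => limn_einf (f ^~ w)).
Proof.
move=> mf; apply: (emeasurable_fun_cvg (fun n w => einfs (f ^~ w) n)).
- exact: measurable_fun_einfs.
- by move=> w _; rewrite limn_einf_lim; exact: is_cvg_einfs.
Qed.

Variable P : probability Omega R.

(** Fatou's lemma applied twice: the iterated lower limit is integrable, hence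
    almost surely finite. *)
Lemma frequently_bounded (f : nat -> nat -> Omega -> R) (K : R) :
  (forall n m, measurable_fun setT (f n m)) ->
  (forall n m w, (0 <= f n m w)%R) ->
  (forall n, \forall m \near \oo, \int[P]_w (f n m w)%:E <= K%:E) ->
  {ae P, forall w, exists C : R, forall n0, exists2 n, (n0 <= n)%N &
    forall m0, exists2 m, (m0 <= m)%N & (f n m w <= C)%R}.
Proof.
move=> mf f0 fK.
pose g n w := limn_einf (fun m => (f n m w)%:E).
pose g' w := limn_einf (g ^~ w).
have einf_ge0 (u : (\bar R)^nat) : (forall n, 0 <= u n) -> 0 <= limn_einf u.
  move=> u0; rewrite limn_einf_lim; apply: lime_ge; first exact: is_cvg_einfs.
  by apply: nearW => n; apply: le_ereal_inf_tmp => _ [k _ <-].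
have mg n : measurable_fun setT (g n).
  by apply: measurable_fun_limn_einf => m; exact/measurable_EFinP.
have g0 n w : 0 <= g n w by apply: einf_ge0 => m; rewrite lee_fin.
have mg' : measurable_fun setT g' by exact: measurable_fun_limn_einf.
have g'0 w : 0 <= g' w by exact: einf_ge0.
have gK n : \int[P]_w g n w <= K%:E.
  apply: le_trans (fatou P measurableT _ _) _.
  - by move=> m; exact/measurable_EFinP.
  - by move=> m w _; rewrite lee_fin.
  - exact: limn_einf_le.
have g'K : \int[P]_w g' w <= K%:E.
  apply: le_trans (fatou P measurableT mg _) _; first by move=> n w _.
  by apply: limn_einf_le; exact: nearW.
have ig' : P.-integrable setT g'.
  apply/integrableP; split => //.
  under eq_integral do rewrite gee0_abs//.
  exact: le_lt_trans g'K (ltry _).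
have := integrable_ae measurableT ig'; apply: filterS => w /(_ I) g'fin.
have /limn_einf_lt_frequently g'lt : g' w < (fine (g' w) + 1)%:E.
  by rewrite EFinD fineK// lteDl// lte_fin.
exists (fine (g' w) + 1)%R => n0.
have [n n0n /limn_einf_lt_frequently gn] := g'lt n0.
exists n => // m0; have [m m0m fm] := gn m0.
by exists m => //; rewrite -lee_fin ltW.
Qed.

End frequently_bounded.

Section brownian_exponent_bounded.
Context {R : realType} {d : measure_display} {Omega : measurableType d}.
Variables (P : probability Omega R) (T : R) (W : R -> {RV P >-> R}).
Hypothesis T_gt0 : (0 < T)%R.
Hypothesis W_bm : is_brownian_motion T W.
Variable b : R -> R.
Hypothesis bP : admissible_drift b.
Variable C : R.
Hypothesis b_growth : forall x : R, (`|b x| <= C * (1 + `|x|))%R.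

Lemma gronwall_exponent_frequently_bounded :
  {ae P, forall w, forall N : nat, exists K : R, forall n0, exists2 n, (n0 <= n)%N &
    forall m0, exists2 m, (m0 <= m)%N &
      gronwall_exponent b T (fun t => W t w) N%:R n.+1%:R^-1 m <= K}.
Proof.
apply: ae_foralln => N.
have e0 n : 0 < n.+1%:R^-1 :> R by rewrite invr_gt0.
apply: frequently_bounded.
- by move=> n m; exact: measurable_gronwall_exponent.
- by move=> n m w; exact: gronwall_exponent_ge0.
- move=> n; have [m0 m0P] := step_small T (exprn_gt0 2 (e0 n)).
  exists m0.+1 => // m /= m0m.
  apply: expected_gronwall_exponent_le => //; first exact: leq_trans m0m.
  by apply: m0P; exact: ltnW.
Qed.

End brownian_exponent_bounded.

(** * Existence of solutions *)

Section ascoli_cluster.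
Context {R : realType}.

(** Cluster points suffice here, so that no subsequence has to be extracted from
    the compactness given by the Arzela-Ascoli theorem. *)
Lemma equicontinuous_cluster (u : nat -> R -> R) :
  equicontinuous [set: nat] u ->
  (forall t, exists M, forall k, `|u k t| <= M) ->
  exists f : R -> R, forall a c e, 0 < e -> forall k0, exists2 k, (k0 <= k)%N &
    forall t, t \in `[a, c] -> `|f t - u k t| < e.
Proof.
move=> u_equi u_bnd; pose A : set (R -> R) := range u.
have hR : hausdorff_space R by exact: Rhausdorff.
have A_equi : equicontinuous A id.
  move=> x E entE; apply: filterS (u_equi x E entE) => y H _ [k _ <-].
  exact: H.
have A_pre : pointwise_precompact A id.
  move=> t; have [M uM] := u_bnd t.
  apply: (@precompact_subset _ _ `[- M, M]%classic).
    move=> _ [_ [k _ <-] <-] /=; rewrite in_itv/=.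
    by have := uM k; rewrite ler_norml.
  apply: compact_precompact => //; exact: segment_compact.
have := @pointwise_precompact_equicontinuous R R hR A A_pre A_equi.
rewrite precompactE.
pose F : set_system {family compact, R -> R} :=
  (u : nat -> {family compact, R -> R}) @ \oo.
have FF : ProperFilter F by exact: fmap_proper_filter.
move=> /(_ F FF)[|f [_ fF]].
  by exists 0%N => // k _ /=; apply: subset_closure; exists k.
exists f => a c e e0 k0.
have entE : entourage [set p : R * R | `|p.1 - p.2| < e].
  by rewrite -entourage_ballE; exists e.
have nf := @fam_nbhs R R compact `[a, c]%classic _ f entE (@segment_compact R a c).
have Fk0 : F [set g | exists2 k, (k0 <= k)%N & g = u k].
  by exists k0 => // k /= k0k; exists k.
have [_ [[k k0k ->] H]] := fF _ _ Fk0 nf.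
by exists k => // t tac; exact: H.
Qed.

End ascoli_cluster.

Section peano.
Context {R : realType}.
Local Notation mu := (@lebesgue_measure R).
Variables (T : R) (omega beta : R -> R) (B : R).
Hypothesis T_gt0 : 0 < T.
Hypothesis omega_cont : {within `[0, T], continuous omega}.
Hypothesis beta_cont : continuous beta.
Hypothesis beta_bnd : forall x, `|beta x| <= B.

Let B_ge0 : 0 <= B.
Proof. exact: le_trans (beta_bnd 0). Qed.

(** Paths are extended to [R] by their values at the ends of [`[0, T]]. *)
Definition freeze (t : R) : R := Num.max 0 (Num.min t T).

Lemma freeze_in (t : R) : freeze t \in `[0, T].
Proof.
by rewrite in_itv/= /freeze le_max lexx/= ge_max (ltW T_gt0) ge_min lexx orbT.
Qed.

Lemma freeze_id (t : R) : t \in `[0, T] -> freeze t = t.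
Proof.
by rewrite in_itv/= => /andP[t0 tT]; rewrite /freeze (min_idPl tT) (max_idPr t0).
Qed.

Lemma freeze_le (s t : R) : s <= t -> freeze s <= freeze t.
Proof. by move=> st; rewrite /freeze; apply: le_max2 => //; apply: le_min2. Qed.

Lemma freeze_increment (s t : R) : s <= t -> freeze t - freeze s <= t - s.
Proof.
move=> st; rewrite /freeze.
case: (lerP t T) => [tT|Tt]; case: (lerP s T) => [sT|Ts];
  rewrite ?(max_idPr (ltW T_gt0)).
- by case: (lerP 0 t); case: (lerP 0 s); lra.
- by lra.
- by case: (lerP 0 s); lra.
- by lra.
Qed.

Let om (t : R) : R := omega (freeze t).

Let om_modulus (e : R) : 0 < e ->
  exists2 d, 0 < d & forall s t, `|s - t| <= d -> `|om s - om t| <= e.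
Proof.
move=> e0; have [d d0 dP] := continuous_segment_modulus e0 omega_cont.
exists d => // s t st; apply: dP; rewrite ?freeze_in//; apply: le_trans st.
wlog ts : s t / t <= s => [H|].
  by have [/H//|/ltW/H] := leP t s; rewrite distrC => /le_trans; apply; rewrite distrC.
rewrite !ger0_norm ?subr_ge0 ?freeze_le//.
exact: freeze_increment.
Qed.

(** The functions that differ from the noise by a [B]-Lipschitz function share
    one modulus of continuity. *)
Let drift_bounded (x : R -> R) : Prop :=
  forall s t, s <= t -> `|x t - x s - (om t - om s)| <= B * (t - s).

Let drift_bounded_modulus (e : R) : 0 < e ->
  exists2 d, 0 < d & forall x, drift_bounded x ->
    forall s t, `|s - t| <= d -> `|x s - x t| <= e.
Proof.
move=> e0; have e20 : 0 < e / 2 by rewrite divr_gt0.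
have [d d0 dP] := om_modulus e20.
have B1 : 0 < B + 1 by rewrite ltr_wpDl.
exists (Num.min d (e / 2 / (B + 1))); first by rewrite lt_min d0 divr_gt0.
move=> x xb s t; wlog ts : s t / t <= s => [H|].
  have [/H//|/ltW/H] := leP t s => + st; rewrite distrC => H'.
  by rewrite (distrC (x s)); apply: H'.
rewrite le_min => /andP[/dP omst]; rewrite ler_pdivlMr// => st.
have := xb _ _ ts; rewrite ger0_norm ?subr_ge0// in st.
move: omst; rewrite !ler_norml => /andP[? ?] /andP[? ?].
by apply/andP; split; nra.
Qed.

Let drift_bounded_continuous (x : R -> R) : drift_bounded x -> continuous x.
Proof.
move=> xb t; apply/cvgrPdist_le => e e0.
have [d d0 dP] := drift_bounded_modulus e0.
by exists d => //= s /ltW; exact: dP.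
Qed.

(** Tonelli's delayed equation. The drift at time [s] looks at the path at time
    [s - delta], so iterating [delayed] determines the solution on one more
    interval of length [delta] each time. *)
Definition delayed (delta : R) (x : R -> R) (t : R) : R :=
  om t + \int[mu]_(s in `[0, freeze t]) beta (x (s - delta)).

Let delayed_integrand (delta : R) (x : R -> R) : drift_bounded x ->
  continuous (fun s => beta (x (s - delta))).
Proof.
move=> xb s.
apply: (@continuous_comp R R R (fun s => x (s - delta))); last exact: beta_cont.
apply: (@continuous_comp R R R (fun s => s - delta));
  last exact: drift_bounded_continuous.
by apply: cvgB; [exact: cvg_id|exact: cvg_cst].
Qed.

Let delayed_bounded (delta : R) (x : R -> R) :
  drift_bounded x -> drift_bounded (delayed delta x).
Proof.
move=> xb s t st; rewrite /delayed.
have fC : {within `[0, T], continuous (fun s => beta (x (s - delta)))}.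
  by apply: continuous_subspaceT; exact: delayed_integrand.
have := freeze_in s; rewrite in_itv/= => /andP[s0 _].
have := freeze_in t; rewrite in_itv/= => /andP[_ tT].
have fst := freeze_le st.
have up : \int[mu]_(s in `[0, freeze t]) beta (x (s - delta)) -
    \int[mu]_(s in `[0, freeze s]) beta (x (s - delta)) <= B * (freeze t - freeze s).
  apply: Rintegral_increment_le fC _ => // r _ _.
  by apply: le_trans (ler_norm _) _.
have lo : - B * (freeze t - freeze s) <=
    \int[mu]_(s in `[0, freeze t]) beta (x (s - delta)) -
    \int[mu]_(s in `[0, freeze s]) beta (x (s - delta)).
  apply: Rintegral_increment_ge fC _ => // r _ _.
  by have := beta_bnd (x (r - delta)); rewrite ler_norml => /andP[].
have : B * (freeze t - freeze s) <= B * (t - s) by rewrite ler_wpM2l// freeze_increment.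
set I1 := (\int[_]_(_ in _) _) in up lo *; set I2 := (\int[_]_(_ in _) _) in up lo *.
by rewrite ler_norml => ?; apply/andP; split; lra.
Qed.

Let iterate (delta : R) (i : nat) : R -> R := iter i (delayed delta) om.

Let iterate_bounded delta i : drift_bounded (iterate delta i).
Proof.
elim: i => [s t st|i IH]; last exact: delayed_bounded.
by rewrite /= subrr normr0 mulr_ge0// subr_ge0.
Qed.

Let om0 (t : R) : t <= 0 -> freeze t = 0.
Proof.
move=> t0; rewrite /freeze; apply/max_idPl.
by rewrite ge_min t0.
Qed.

Let iterate_stable (delta : R) (i : nat) (t : R) : 0 < delta -> t <= i%:R * delta ->
  iterate delta i.+1 t = iterate delta i t.
Proof.
move=> delta0; elim: i t => [|i IH] t ti.
  rewrite mul0r in ti.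
  by rewrite /= /delayed om0// Rintegral_itv00 addr0.
rewrite /= /delayed; congr (_ + _); apply: eq_Rintegral => s.
rewrite inE /= in_itv/= => /andP[s0 st].
congr beta; apply: IH; rewrite lerBlDr.
apply: (@le_trans _ _ (Num.max 0 t)); last first.
  rewrite ge_max addr_ge0 ?mulr_ge0 ?(ltW delta0)//=.
  by move: ti; rewrite -natr1 mulrDl mul1r.
apply: le_trans st _; rewrite /freeze; apply: le_max2 => //.
by rewrite ge_min lexx.
Qed.

Let delayed_solution (delta : R) : 0 < delta -> exists x : R -> R,
  [/\ drift_bounded x, x 0 = om 0 & forall t, t \in `[0, T] ->
    x t = omega t + \int[mu]_(s in `[0, t]) beta (x (s - delta))].
Proof.
move=> delta0; pose i := (Num.truncn (T / delta)).+1.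
have iT : T <= i%:R * delta by rewrite -ler_pdivrMr//; exact/ltW/truncnS_gt.
exists (iterate delta i); split; first exact: iterate_bounded.
  rewrite -iterate_stable// ?mulr_ge0 ?(ltW delta0)//=.
  by rewrite /delayed om0// Rintegral_itv00 addr0.
move=> t tT; move: (tT); rewrite in_itv/= => /andP[t0 tT'].
rewrite -[LHS](iterate_stable delta0 (le_trans tT' iT)).
by rewrite /= /delayed /om freeze_id.
Qed.

(** Peano's theorem: the solutions of the delayed equations cluster at a solution
    as the delay tends to zero. *)
Lemma peano_bounded : exists x, is_solution T beta omega x.
Proof.
have delta0 k : 0 < k.+1%:R^-1 :> R by rewrite invr_gt0.
have /choice[u uP] k := delayed_solution (delta0 k).
have ub k : drift_bounded (u k) by have [] := uP k.
have u0 k : u k 0 = om 0 by have [] := uP k.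
have uE k t : t \in `[0, T] ->
    u k t = omega t + \int[mu]_(s in `[0, t]) beta (u k (s - k.+1%:R^-1)).
  by have [_ _] := uP k; apply.
have u_near k t : `|u k t - om t| <= B * `|t|.
  have [t0|/ltW t0] := leP 0 t.
    have := ub k _ _ t0; rewrite u0 (ger0_norm t0) subr0.
    by rewrite (_ : u k t - om 0 - (om t - om 0) = u k t - om t)//; ring.
  have := ub k _ _ t0; rewrite u0 (ler0_norm t0) sub0r.
  rewrite (_ : om 0 - u k t - (om 0 - om t) = - (u k t - om t)) ?normrN//; ring.
have u_equi : equicontinuous [set: nat] u.
  move=> t E; rewrite -entourage_ballE => -[e /= e0 eE].
  have [d d0 dP] := drift_bounded_modulus (divr_gt0 e0 (ltr0n R 2)).
  exists d => //= s /ltW ts k _; apply: eE => /=.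
  rewrite /ball /=; apply: le_lt_trans (dP _ (ub k) _ _ ts) _.
  by rewrite ltr_pdivrMr// ltr_pMr// ltr1n.
have u_bnd t : exists M, forall k, `|u k t| <= M.
  exists (`|om t| + B * `|t|) => k.
  rewrite -[X in `|X|](subrKC (om t)); apply: le_trans (ler_normD _ _) _.
  by rewrite lerD2l.
have [f fP] := equicontinuous_cluster u_equi u_bnd.
have fC : {within `[0, T], continuous f}.
  apply/subspace_continuousP => t tT; apply/cvgrPdist_le => e e0.
  have e30 : 0 < e / 3 by rewrite divr_gt0.
  have [d d0 dP] := drift_bounded_modulus e30.
  have [k _ kP] := fP 0 T _ e30 0%N.
  exists d => //= s /ltW ts sT; suff : `|f t - f s| <= e by [].
  have h1 := ltW (kP t tT); have h2 := ltW (kP s sT); have h3 := dP _ (ub k) _ _ ts.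
  move: h1 h2 h3; rewrite !ler_norml => /andP[? ?] /andP[? ?] /andP[? ?].
  by apply/andP; split; lra.
have bfC : {within `[0, T], continuous (beta \o f)} by exact: within_continuous_comp.
exists f; split=> // t tT; apply/eqP; rewrite -subr_eq0 -normr_le0.
apply/ler_addgt0Pr => e e0; rewrite add0r.
have [M0 M0P] := continuous_segment_bounded omega_cont.
pose M := M0%:R + B * (T + 1) + 1.
have BT0 : 0 <= B * (T + 1) by rewrite mulr_ge0// addr_ge0// ltW.
have u_le k s : -1 <= s -> s <= T -> `|u k s| <= M - 1.
  move=> s1 sT; rewrite -[X in `|X|](subrKC (om s)); apply: le_trans (ler_normD _ _) _.
  rewrite /M addrK; apply: lerD; first exact/M0P/freeze_in.
  apply: le_trans (u_near k s) _; rewrite ler_wpM2l// ler_norml.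
  by apply/andP; split; have := T_gt0; lra.
have e'0 : 0 < e / (2 * T) by rewrite divr_gt0// mulr_gt0.
have bMC : {within `[- M, M], continuous beta} by exact: continuous_subspaceT.
have [d1 d10 d1P] := continuous_segment_modulus e'0 bMC.
have d120 : 0 < d1 / 2 by rewrite divr_gt0.
have [d2 d20 d2P] := drift_bounded_modulus d120.
pose eps := Num.min (Num.min (d1 / 2) (e / 2)) 1.
have eps0 : 0 < eps by rewrite !lt_min d120 divr_gt0// ltr01.
have [k kd kP] := fP 0 T eps eps0 (Num.truncn d2^-1).
have dk : k.+1%:R^-1 <= d2.
  rewrite invf_ple ?posrE ?ltr0n//; apply/ltW/(lt_le_trans (truncnS_gt _)).
  by rewrite ler_nat.
have dk1 : k.+1%:R^-1 <= 1 :> R by rewrite invf_le1 ?ltr0n// ler1n.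
move: (tT); rewrite in_itv/= => /andP[t0 tT'].
have gC' : {within `[0, T], continuous (fun s : R => beta (u k (s - k.+1%:R^-1)))}.
  by apply: continuous_subspaceT; exact: delayed_integrand.
pose D s := beta (f s) - beta (u k (s - k.+1%:R^-1)).
have DC : {within `[0, T], continuous D}.
  by move=> x; exact: (cvgB (bfC x) (gC' x)).
have Dle s : 0 <= s -> s <= t -> `|D s| <= e / (2 * T).
  move=> s0 st; have sT : s \in `[0, T] by rewrite in_itv/= s0 (le_trans st).
  have fu := ltW (kP s sT).
  have uu : `|u k s - u k (s - k.+1%:R^-1)| <= d1 / 2.
    by apply: d2P; rewrite // opprB addrC subrK ger0_norm// ltW.
  have sT' : s <= T by rewrite (le_trans st).
  have u1 : `|u k s| <= M - 1 by apply: u_le => //; lra.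
  have u2 : `|u k (s - k.+1%:R^-1)| <= M - 1.
    by move: (delta0 k) dk1; set q := k.+1%:R^-1 => ? ?; apply: u_le; lra.
  have eps1 : eps <= 1 by rewrite ge_min lexx orbT.
  have epsd : eps <= d1 / 2 by rewrite !ge_min lexx.
  apply: d1P.
  - rewrite in_itv/= -ler_norml; move: fu u1; rewrite !ler_norml.
    by move=> /andP[? ?] /andP[? ?]; apply/andP; split; lra.
  - rewrite in_itv/= -ler_norml; move: u2; rewrite !ler_norml.
    by move=> /andP[? ?]; apply/andP; split; lra.
  - move: fu uu; rewrite !ler_norml.
    by move=> /andP[? ?] /andP[? ?]; apply/andP; split; lra.
have IE : \int[mu]_(s in `[0, t]) D s = \int[mu]_(s in `[0, t]) beta (f s) -
    \int[mu]_(s in `[0, t]) beta (u k (s - k.+1%:R^-1)).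
  apply: RintegralB => //.
  - exact: (integrable_within_continuous (lexx 0) tT' bfC).
  - exact: (integrable_within_continuous (lexx 0) tT' gC').
have up : \int[mu]_(s in `[0, t]) D s <= e / (2 * T) * t.
  have := @Rintegral_increment_le _ D T 0 t (e / (2 * T)) (lexx 0) t0 tT' DC.
  rewrite Rintegral_itv00 !subr0; apply => r r0 rt.
  exact: le_trans (ler_norm _) (Dle r r0 rt).
have lo : - (e / (2 * T)) * t <= \int[mu]_(s in `[0, t]) D s.
  have := @Rintegral_increment_ge _ D T 0 t (- (e / (2 * T))) (lexx 0) t0 tT' DC.
  rewrite Rintegral_itv00 !subr0; apply => r r0 rt.
  by have := Dle r r0 rt; rewrite ler_norml => /andP[].
have et : e / (2 * T) * t <= e / 2.
  have -> : e / 2 = e / (2 * T) * T by field; rewrite gt_eqF.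
  by rewrite ler_wpM2l// ltW.
have epse : eps <= e / 2 by rewrite !ge_min lexx orbT.
have fu := ltW (kP t tT); rewrite uE// in fu.
move: fu; rewrite IE in up lo; rewrite !ler_norml => /andP[? ?].
by apply/andP; split; lra.
Qed.

End peano.

Section existence.
Context {R : realType}.
Local Notation mu := (@lebesgue_measure R).
Variables (T : R) (omega b : R -> R) (C : R).
Hypothesis T_gt0 : 0 < T.
Hypothesis omega_cont : {within `[0, T], continuous omega}.
Hypothesis b_cont : continuous b.
Hypothesis b_growth : forall x, `|b x| <= C * (1 + `|x|).

Let C_ge0 : 0 <= C.
Proof. by have := b_growth 0; rewrite normr0 addr0 mulr1; apply: le_trans. Qed.

(** A Gronwall bound in its simplest form: with steps [h] such that
    [C * h <= 1 / 2], the quantity [1 + M] plus the integral of [C * (1 + `|x|)]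
    at most doubles on each step. *)
Lemma solution_bounded (beta x : R -> R) (M : R) (n : nat) :
  continuous beta -> (forall x, `|beta x| <= C * (1 + `|x|)) ->
  (forall r, r \in `[0, T] -> `|omega r| <= M) -> 2 * C * T <= n.+1%:R ->
  is_solution T beta omega x ->
  forall t, t \in `[0, T] -> `|x t| <= (1 + M) * 2 ^+ n.+1.
Proof.
move=> beta_cont beta_growth omM Tn [xC xE].
pose g r := C * (1 + `|x r|).
have gC : {within `[0, T], continuous g}.
  move=> r; apply: cvgM; first exact: cvg_cst.
  apply: cvgD; first exact: cvg_cst.
  by apply: cvg_norm; exact: xC.
have bC : {within `[0, T], continuous (beta \o x)} by exact: within_continuous_comp.
pose v t := 1 + M + \int[mu]_(r in `[0, t]) g r.
have xv t : t \in `[0, T] -> 1 + `|x t| <= v t.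
  move=> tT; rewrite /v -addrA lerD2l xE// [X in `|X|]addrC.
  apply: le_trans (ler_normD _ _) _; apply: lerD; first exact: omM.
  move: tT; rewrite in_itv/= => /andP[t0 tT].
  have ib := integrable_within_continuous (lexx 0) tT bC.
  apply: le_trans (le_normr_Rintegral _ ib) _ => //.
  apply: le_Rintegral => //.
  - exact: integrable_norm ib.
  - exact: (integrable_within_continuous (lexx 0) tT gC).
  - by move=> r _; exact: beta_growth.
have v_mono s t : 0 <= s -> s <= t -> t <= T -> v s <= v t.
  move=> s0 st tT; rewrite /v lerD2l -subr_ge0.
  have := @Rintegral_increment_ge _ g T s t 0 s0 st tT gC.
  by rewrite mul0r; apply => r _ _; rewrite mulr_ge0// addr_ge0.
have n0 : 0 < n.+1%:R :> R by rewrite ltr0n.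
pose h := T / n.+1%:R.
have h0 : 0 < h by rewrite divr_gt0.
have Ch : C * h <= 1 / 2.
  by rewrite /h mulrA ler_pdivrMr// mulrC; move: Tn; lra.
have double j : (j <= n.+1)%N -> v (h * j%:R) <= (1 + M) * 2 ^+ j.
  elim: j => [_|j IH jn]; first by rewrite mulr0 /v Rintegral_itv00 addr0 expr0 mulr1.
  have jT : h * j.+1%:R <= T.
    by rewrite /h mulrAC ler_pdivrMr// ler_wpM2l ?(ltW T_gt0)// ler_nat.
  have j0 : 0 <= h * j%:R by rewrite mulr_ge0// ltW.
  have jj : h * j%:R <= h * j.+1%:R by rewrite ler_pM2l// ler_nat.
  have : v (h * j.+1%:R) - v (h * j%:R) <= C * v (h * j.+1%:R) * (h * j.+1%:R - h * j%:R).
    rewrite {1 2}/v opprD addrACA subrr add0r.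
    apply: Rintegral_increment_le gC _ => // r rj rj'.
    rewrite /g ler_wpM2l//.
    apply: le_trans (v_mono r _ (le_trans j0 rj) rj' jT).
    by apply: xv; rewrite in_itv/= (le_trans j0 rj) (le_trans rj' jT).
  have -> : h * j.+1%:R - h * j%:R = h by rewrite -natr1; ring.
  have v0 : 0 <= v (h * j.+1%:R).
    apply: le_trans (xv _ _); first by rewrite addr_ge0.
    by rewrite in_itv/= (le_trans j0 jj).
  have := IH (ltnW jn).
  rewrite exprS; nra.
move=> t tT; have := xv t tT; move: tT; rewrite in_itv/= => /andP[t0 tT].
have := v_mono t T t0 tT (lexx T).
have := double n.+1 (leqnn _); rewrite {1}/h divfK ?gt_eqF//.
lra.
Qed.

(** The a priori bound is the same for [b] and for its truncations, so a solution
    for the truncation at that bound never sees the truncation. *)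
Lemma solution_exists : exists x, is_solution T b omega x.
Proof.
have [M MP] := continuous_segment_bounded omega_cont.
pose n := Num.truncn (2 * C * T).
pose N : R := (1 + M%:R) * 2 ^+ n.+1.
have N0 : 0 <= N by rewrite mulr_ge0 ?addr_ge0 ?exprn_ge0.
pose beta x := b (clip N x).
have beta_cont : continuous beta.
  move=> x; apply: (@continuous_comp R R R (clip N) b); last exact: b_cont.
  exact: clip_continuous.
have beta_bnd x : `|beta x| <= C * (1 + N).
  by apply: le_trans (b_growth _) _; rewrite ler_wpM2l// lerD2l norm_clip.
have clip_norm x : `|clip N x| <= `|x|.
  have [xN|Nx] := leP `|x| N; first by rewrite clip_id.
  by apply: le_trans (norm_clip _ N0) (ltW Nx).
have beta_growth x : `|beta x| <= C * (1 + `|x|).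
  by apply: le_trans (b_growth _) _; rewrite ler_wpM2l// lerD2l.
have [x xsol] := peano_bounded T_gt0 omega_cont beta_cont beta_bnd.
exists x; have [xC xE] := xsol; split=> // t tT; rewrite xE//; congr (_ + _).
apply: eq_Rintegral => s; rewrite inE /= in_itv/= => /andP[s0 st].
rewrite /beta clip_id//.
apply: (solution_bounded beta_cont beta_growth MP _ xsol); first exact/ltW/truncnS_gt.
by move: tT; rewrite !in_itv/= => /andP[_ tT]; rewrite s0 (le_trans st).
Qed.

End existence.

(** * Path-by-path uniqueness *)

Theorem theorem2p6 (R : realType) (d : measure_display)
    (Omega : measurableType d) (P : probability Omega R) (T : R)
    (W : R -> {RV P >-> R}) (b : R -> R)
    (T_gt0 : 0 < T)
    (W_bm : is_brownian_motion T W)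
    (H1 : b 0 = 0)
    (H2 : {in `]0, +oo[ &, nondecreasing_fun b})
    (H3 : [/\ {within `[0, +oo[, continuous b},
              {in `]0, +oo[, forall x : R, derivable b x 1},
              {in `]0, +oo[, continuous (derive1 b)} &
              {in `]0, +oo[ &, nonincreasing_fun (derive1 b)}])
    (H4 : forall x : R, b `|x| <= b (- `|x|))
    (H5 : {in `]-oo, 0] &, nonincreasing_fun b})
    (H6 : continuous b /\ exists C : R, forall x : R, `|b x| <= C * (1 + `|x|))
    (H7 : (\int[P]_w \int[lebesgue_measure]_(s in `[0%R, T])
             right_limit_derive1 b `|W s w| < +oo)%E) :
  unique_path_by_path_solution P T b W.
Proof.
have [b_cont [C b_growth]] := H6.
have [_ b_derivable b'_cont b'_ni] := H3.
have bP : admissible_drift b by split.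
have exponent_bnd := gronwall_exponent_frequently_bounded T_gt0 W_bm bP b_growth.
have start := bm_start W_bm; have W_cont := bm_continuous W_bm.
apply: filterS3 start W_cont exponent_bnd => w W0 Wc bnd.
have [x xsol] := solution_exists T_gt0 Wc b_cont b_growth.
exists x; split=> // y ysol t tT; apply/eqP; rewrite eq_le.
have le x1 x2 := solutions_le bP T_gt0 W0 (x := x1) (y := x2) bnd.
by rewrite (le x y)// (le y x).
Qed.
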